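(* Let $\theta>0$ and let $\mathbf P$ be a GEM$(\theta)$ sequence. Let $\mathbf T=\{T_j\}_{j\ge1}$ be a homogeneous Markov chain on a discrete space $\mathcal X$, independent of $\mathbf P$, with transition kernel $Q$ and initial distribution $\mu$. Let $\mathbf V$ be the switch times of $\mathbf T$, $\mathbf P^{\mathbf V}$ the corresponding clumped measure, and $\mathbf Y=\{T_{V_j}\}_{j\ge1}$. Then $\mathbf Y$ is a homogeneous Markov chain with kernel $K_{\theta(Q-I)}$, and for every possible sequence $\mathbf y$ of $\mathbf Y$, $\mathbf P^{\mathbf V}\mid\mathbf Y=\mathbf y$ is a disordered GEM with parameters $\{\theta(1-Q_{y_j,y_j})\}_{j\ge1}$. That is, $(\mathbf P^{\mathbf V},\mathbf Y)$ has the MCcGEM$(\theta(Q-I))$ distribution with respect to $\mu$.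
   Context: Conventions: empty sums $0$, empty products $1$, $1/0=\infty$, $0/0=0$, $0^0=1$; a Beta$(1,0)$ variable equals $1$ a.s. RAM constructed from independent $[0,1]$-valued fractions $\{X_j\}$: $P_j=X_j\prod_{i<j}(1-X_i)$, required to sum to $1$ a.s. GEM$(\theta)$: the RAM with i.i.d. Beta$(1,\theta)$ fractions. Disordered GEM with parameters $\{\theta_j\}_{j\ge1}$ ($\theta_j\ge0$): the RAM with independent fractions $X_j\sim$ Beta$(1,\theta_j)$. Switch times: $V_1=1$, $V_{j+1}=\inf\{v>V_j:T_v\ne T_{v-1}\}$ ($\inf\emptyset=\infty$); $Y_j=T_{V_j}$ if $V_j<\infty$ and $Y_j$ equals the absorbing state reached otherwise. Clumped measure $\mathbf P^{\mathbf V}$: $P^V_j=\sum_{i=V_j}^{V_{j+1}-1}P_i$ if $V_j<\infty$, else $0$. A generator kernel on $\mathcal X$ is a matrix $G$ with $G_{i,j}\ge0$ for $i\ne j$, $G_{i,i}=-\sum_{j\ne i}G_{i,j}$, and $\sup_i|G_{i,i}|<\infty$. For a generator $G$, $K_G(w,z)=G_{w,z}/(-G_{w,w})$ if $w\ne z$ and $G_{w,w}\ne0$; $K_G(w,z)=1$ if $w=z$ and $G_{w,w}=0$; $K_G(w,z)=0$ otherwise. MCcGEM$(G)$ distribution with respect to $\mu$: the law of a pair $(\mathbf P,\mathbf Y)$ where $\mathbf Y$ is a homogeneous Markov chain with initial law $\mu$ and kernel $K_G$, and conditionally on $\mathbf Y=\mathbf y$ the variables $X_j$ are independent with $X_j\sim$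 Beta$(1,-G_{y_j,y_j})$, and $P_j=X_j\prod_{i<j}(1-X_i)$. A possible sequence $\mathbf y$ of $\mathbf Y$: $\mathbb P(Y_i=y_i,1\le i\le n)>0$ for all $n$. *)

(* Defs.v *)
From HB Require Import structures.
From mathcomp Require Import all_boot all_order all_algebra.
From mathcomp Require Import all_classical all_reals all_analysis.
Set Implicit Arguments. Unset Strict Implicit. Unset Printing Implicit Defensive.
Import Order.TTheory GRing.Theory Num.Theory.
Import numFieldNormedType.Exports.
Local Open Scope classical_set_scope.
Local Open Scope ring_scope.

(** Indices are 0-based throughout: index j here stands for index j+1 of the
    paper (so T 0 = T_1, V 0 = V_1 = "time 1", etc.). *)

Section Defs.
Context {R : realType}.

(** Integral of f against Beta(1,a), for a >= 0.  For a > 0 Beta(1,a) has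
    density a (1-x)^(a-1) on [0,1]; Beta(1,0) is the point mass at 1. *)
Definition beta1_int (a : R) (f : R -> \bar R) : \bar R :=
  if a == 0 then f 1
  else (\int[@lebesgue_measure R]_(x in `[0%R, 1%R])
          (f x * (a * (1 - x) `^ (a - 1))%:E))%E.

(** The n-fold product measure of Beta(1,a_1) x ... x Beta(1,a_n), evaluated
    on a set A of sequences, defined by iterated integration of sections
    (as for [product_measure1]). *)
Fixpoint beta1_prod (as_ : seq R) (A : set (seq R)) : \bar R :=
  match as_ with
  | [::] => (\1_A [::])%:E
  | a :: as' => beta1_int a (fun x => beta1_prod as' [set s | A (x :: s)])
  end.

Definition stick (xs : seq R) (j : nat) : R :=
  xs`_j * \prod_(i < j) (1 - xs`_i).

Definition tup (n : nat) (f : nat -> R) : n.-tuple R := [tuple f i | i < n].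

End Defs.

Section Markov.
Context {R : realType} {X : countType}.

Fixpoint chain_prod (K : X -> X -> R) (y : X) (ys : seq X) : R :=
  match ys with
  | [::] => 1
  | z :: zs => K y z * chain_prod K z zs
  end.

Definition markov_prob (mu : X -> R) (K : X -> X -> R) (ys : seq X) : R :=
  match ys with
  | [::] => 1
  | y :: zs => mu y * chain_prod K y zs
  end.

Definition gen_kernel (G : X -> X -> R) (w z : X) : R :=
  if w != z then (if G w w != 0 then G w z / (- G w w) else 0)
  else (if G w w == 0 then 1 else 0).

Definition theta_QmI (theta : R) (Q : X -> X -> R) (x y : X) : R :=
  theta * (Q x y - (x == y)%:R).

(** Joint finite-dimensional law of (P, Z) where Z is a homogeneous Markov
    chain (initial law mu, kernel K) and, conditionally on Z = z, P is the RAM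
    with independent fractions X_j ~ Beta(1, par z_j).  Since Z is discrete,
    this is the statement that for every n, every z_1..z_n and every measurable
    A in R^n,
      Pr(Z_i = z_i (i <= n), (P_1..P_n) in A)
        = mu(z_1) prod K(z_i,z_{i+1}) * (prod_i Beta(1, par z_i))(stick^-1 A). *)
Definition markov_RAM_law {d} {Omega : measurableType d}
  (Pr : probability Omega R) (P : nat -> Omega -> R) (Z : nat -> Omega -> X)
  (mu : X -> R) (K : X -> X -> R) (par : X -> R) : Prop :=
  forall (n : nat) (zs : n.-tuple X) (A : set (n.-tuple R)),
    measurable A ->
    Pr [set w | (forall i : 'I_n, Z i w = tnth zs i) /\
                A (tup n (fun i => P i w))]
    = ((markov_prob mu K zs)%:E *
       beta1_prod (map par zs) [set xs | A (tup n (stick xs))])%E.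

(** P is GEM(theta), T is a homogeneous Markov chain (mu, Q), independent of P:
    the joint law is the product of the Markov law and the GEM(theta) law
    (i.i.d. Beta(1,theta) fractions). *)
Definition GEM_indep_markov {d} {Omega : measurableType d}
  (Pr : probability Omega R) (theta : R) (P : nat -> Omega -> R)
  (T : nat -> Omega -> X) (mu : X -> R) (Q : X -> X -> R) : Prop :=
  markov_RAM_law Pr P T mu Q (fun _ => theta).

Definition MCcGEM {d} {Omega : measurableType d}
  (Pr : probability Omega R) (G : X -> X -> R) (mu : X -> R)
  (P : nat -> Omega -> R) (Y : nat -> Omega -> X) : Prop :=
  markov_RAM_law Pr P Y mu (gen_kernel G) (fun y => - G y y).

(** Switch times (pathwise).  None stands for infinity. *)
Definition next_switch (t : nat -> X) (v : nat) : option nat :=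
  match pselect (exists w, ((v < w)%N && (t w != t w.-1))) with
  | left H => Some (ex_minn H)
  | right _ => None
  end.

Fixpoint switch (t : nat -> X) (j : nat) : option nat :=
  match j with
  | 0 => Some 0%N
  | j'.+1 => match switch t j' with
             | None => None
             | Some v => next_switch t v
             end
  end.

(** Y_j = T_{V_j} if V_j < oo, else the absorbing state reached. *)
Fixpoint switch_state (t : nat -> X) (j : nat) : X :=
  match j with
  | 0 => t 0%N
  | j'.+1 => match switch t j'.+1 with
             | Some v => t v
             | None => switch_state t j'
             end
  end.

Definition clump (t : nat -> X) (p : nat -> R) (j : nat) : R :=
  match switch t j with
  | None => 0
  | Some v => match switch t j.+1 with
              | Some w => \sum_(v <= i < w) p i
              | None => limn (fun m => \sum_(v <= i < m) p i)
              end
  end.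

End Markov.

(* Main.v *)
Require Import Defs.
From HB Require Import structures.
From mathcomp Require Import all_boot all_order all_algebra.
From mathcomp Require Import all_classical all_reals all_analysis.
From mathcomp Require Import measurable_realfun ring lra zify.
Import Order.TTheory GRing.Theory Num.Theory.
Import numFieldNormedType.Exports.
Local Open Scope classical_set_scope.
Local Open Scope ring_scope.
Set Implicit Arguments.
Unset Strict Implicit.
Unset Printing Implicit Defensive.

(** After k letters of a block the remaining mass of the stick has been
    multiplied by k independent Beta(th,1) factors.  If the chain stays in the
    current state with probability q, the block ends after a geometric number of
    letters, and the total factor V satisfies in law
      V = U with probability 1 - q,  V = U V' with probability q,
    where U is Beta(th,1) and V' an independent copy of V.  A density computation
    shows that Beta(th (1 - q), 1) solves this equation ([beta1_int_geom]).

    For a word t of T, put L(t) = Pr(T starts with t, Y = zs, P^V in A), and let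
    R(t) be the value that the MCcGEM law predicts for L(t) when the letters of t
    before the last one use up i.i.d. Beta(1,th) fractions and the current and
    the later blocks use one fraction Beta(1, th (1 - Q z z)) each.  By the
    equation above, L and R satisfy the same one-step recursion in t.  Induction
    on the number of blocks left to open disposes of the words that leave the
    current block, so L - R is constant along the words t z z z ..., where
    |L - R| <= C Pr(t) q^k; hence L = R whenever q < 1.  If q = 1, then T stays
    at z and P sums to 1, so the last clump is the mass that is left.  The theorem
    is L = R for the one-letter words. *)

(** * Mixtures of Beta(1,a) integrals *)

Lemma ge0_integral_lin d (T : measurableType d) (R : realType)
    (mu : {measure set T -> \bar R}) (D : set T) (c e : R) (F G H : T -> \bar R) :
  measurable D -> 0 <= c -> 0 <= e ->
  measurable_fun D G -> measurable_fun D H ->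
  (forall x, D x -> 0 <= G x)%E -> (forall x, D x -> 0 <= H x)%E ->
  (forall x, D x -> F x = c%:E * G x + e%:E * H x)%E ->
  (\int[mu]_(x in D) F x =
   c%:E * \int[mu]_(x in D) G x + e%:E * \int[mu]_(x in D) H x)%E.
Proof.
move=> mD c0 e0 mG mH G0 H0 FGH.
rewrite -(ge0_integralZl mu mD mG G0) ?lee_fin// -(ge0_integralZl mu mD mH H0) ?lee_fin//.
rewrite -ge0_integralD//; first by apply: eq_integral => x; rewrite inE; exact: FGH.
- by move=> x Dx; rewrite mule_ge0 ?lee_fin// G0.
- exact: measurable_funeM.
- by move=> x Dx; rewrite mule_ge0 ?lee_fin// H0.
- exact: measurable_funeM.
Qed.

Section Beta.
Context {R : realType}.
Local Notation lam := (@lebesgue_measure R).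

Let affine (c r : R) (y : measurableTypeR R) : measurableTypeR R := c + r * y.

Let measurable_affine (c r : R) :
  measurable_fun [set: measurableTypeR R] (affine c r).
Proof. by apply: measurable_funD => //; apply: measurable_funM. Qed.

(** Multiplied by [r], the pushforward gives every interval ]a, b] its length, so the uniqueness of
    Lebesgue measure applies. *)
Let lebesgue_measure_affine (c r : R) (r0 : 0 < r) (A : set (measurableTypeR R)) :
  measurable A ->
  pushforward lam (affine c r) A = ((r^-1)%:E * lam A)%E.
Proof.
move=> mA.
suff -> : lam A = (r%:E * pushforward lam (affine c r) A)%E.
  by rewrite muleA -EFinM mulVf ?gt_eqF // mul1e.
pose m : {measure set (measurableTypeR R) -> \bar R} :=
  measure_function_pushforward__canonical__measure_function_Measure lam (measurable_affine c r).
apply: (@lebesgue_measure_unique R (mscale (NngNum (ltW r0)) m)) => // X [[a b] _ <-].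
rewrite /= /mscale /m /pushforward /=.
rewrite [X in (_ * lam X)%E](_ : _ = `](a - c) / r, (b - c) / r]%classic); last first.
  apply/seteqP; split => y /=;
  by rewrite !in_itv /= /affine ltr_pdivrMr // ler_pdivlMr // ltrBlDl lerBrDl (mulrC y).
rewrite !lebesgue_measure_itv /= !lte_fin ltr_pM2r ?invr_gt0 // ltrD2r.
case: ifPn => _; last by rewrite mule0.
rewrite -!EFinB -EFinM; congr (_%:E); field.
by rewrite gt_eqF.
Qed.

Lemma integral_affine (g : R -> \bar R) (c r : R) : 0 < r ->
  measurable_fun [set: R] g -> (forall x, (0 <= g x)%E) ->
  (\int[lam]_(y in `[0%R, 1%R]) g (c + r * y)%R =
   (r^-1)%:E * \int[lam]_(w in `[c, (c + r)%R]) g w)%E.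
Proof.
move=> r0 mg g0.
have -> : (`[0%R, 1%R]%classic : set R) = affine c r @^-1` `[c, c + r]%classic.
  apply/seteqP; split => y /=;
  by rewrite !in_itv /= /affine lerDl lerD2l pmulr_rge0 // -{2}(mulr1 r) ler_pM2l.
have ri : 0 <= r^-1 by rewrite invr_ge0 ltW.
have := @ge0_integral_pushforward _ _ (measurableTypeR R) (measurableTypeR R) R _
  (measurable_affine c r) lam
  `[c, c + r]%classic g.
rewrite /comp => <- //; last exact: measurable_funTS.
rewrite -(@ge0_integral_mscale _ _ _ lam `[c, c+r]%classic _ (NngNum ri)) //.
  apply: eq_measure_integral => /= A mA _.
  by rewrite lebesgue_measure_affine.
exact: measurable_funTS.
Qed.

Let is_derive_onem_powR (c x : R) : x < 1 ->
  is_derive x (1:R) (fun y : R => (1 - y) `^ c) (- (c * (1 - x) `^ (c - 1))).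
Proof.
move=> x1; have x10 : 0 < 1 - x by rewrite subr_gt0.
have d1 : is_derive x (1:R) (fun y : R => 1 - y) (-1).
  by rewrite -[X in is_derive _ _ _ X]sub0r; apply: is_deriveB.
have d2 : is_derive (1 - x) (1:R) (fun y : R => y `^ c) (c * (1 - x) `^ (c - 1)).
  exact: is_derive1_powR.
by have := @is_derive1_comp _ (fun y : R => y `^ c) (fun y : R => 1 - y) x _ _ d2 d1; rewrite
  mulrN1.
Qed.

Let continuous_onem_powR (c x : R) : x < 1 ->
  {for x, continuous (fun y : R => (1 - y) `^ c)}.
Proof.
move=> x1; apply: differentiable_continuous; apply/derivable1_diffP.
by have [] := is_derive_onem_powR c x1.
Qed.

(** Fundamental theorem of calculus for the primitive - (1 - y)^c / c. Keeping [w] below 1 avoids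
    the singularity at 1, so any nonzero exponent [c] is allowed. *)
Lemma integral_onem_powR (c w : R) : c != 0 -> 0 <= w < 1 ->
  (\int[lam]_(y in `[0%R, w]) ((1 - y) `^ (c - 1))%:E = ((1 - (1 - w) `^ c) / c)%:E)%E.
Proof.
move=> c0 /andP[]; rewrite le_eqVlt => /orP[/eqP <- _|w0 w1].
  by rewrite set_itv1 integral_set1 subr0 powR1 subrr mul0r.
pose F := (- c^-1) *: (fun y : R => (1 - y) `^ c).
have dF (x : R) : x < 1 -> is_derive x (1:R) F ((1 - x) `^ (c - 1)).
  move=> x1; have d := is_derive_onem_powR c x1.
  have := is_deriveZ (- c^-1) d.
  by rewrite /GRing.scale /= mulrN mulNr opprK mulrA mulVf // mul1r.
have cF (x : R) : x < 1 -> {for x, continuous F}.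
  move=> x1; apply: differentiable_continuous; apply/derivable1_diffP.
  by have [] := dF x x1.
rewrite (@continuous_FTC2 _ _ F) //.
- rewrite -EFinB -[F w]/(- c^-1 * (1 - w) `^ c) -[F 0]/(- c^-1 * (1 - 0) `^ c).
  by rewrite subr0 powR1; congr (_%:E); field.
- apply: continuous_in_subspaceT => x; rewrite inE /= in_itv /= => /andP[_ xw].
  by apply: continuous_onem_powR; exact: le_lt_trans xw w1.
- split.
  + move=> x; rewrite in_itv /= => /andP[_ xw].
    by have [] := dF x (lt_trans xw w1).
  + by apply: cvg_at_right_filter; apply: cF.
  + by apply: cvg_at_left_filter; apply: cF.
- move=> x; rewrite in_itv /= => /andP[_ xw].
  have [_ <-] := dF x (lt_trans xw w1).
  by rewrite derive1E.
Qed.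

Lemma beta1_int_ge0 (a : R) f : 0 <= a -> (forall x, 0 <= x <= 1 -> (0 <= f x)%E) ->
  (0 <= beta1_int a f)%E.
Proof.
move=> a0 f0; rewrite /beta1_int; case: ifP => _; first by apply: f0; rewrite ler01 lexx.
apply: integral_ge0 => x; rewrite /= in_itv /= => x01.
by rewrite mule_ge0 ?f0// lee_fin mulr_ge0// powR_ge0.
Qed.

Lemma measurable_onem_powR (a b : R) :
  measurable_fun [set: R] (fun x : R => (a * (1 - x) `^ b)%:E).
Proof.
apply/measurable_EFinP; apply: measurable_funM => //.
apply: (@measurableT_comp _ _ _ _ _ _ (@powR R ^~ b)); first exact: measurable_powR.
exact: measurable_funB.
Qed.

Let measurable_dens (a b : R) :
  measurable_fun [set: R] (fun x : R => (a * (1 - x) `^ b)%:E).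
Proof. exact: measurable_onem_powR. Qed.

(** The density blows up at 1 when [a] is below 1, so the total mass is computed as the monotone
    limit of the integrals over [0, 1 - 1/(n + 1)], which equal 1 - (1/(n + 1))^a. *)
Lemma beta1_int_cst (a k : R) : 0 <= a -> 0 <= k -> beta1_int a (fun=> k%:E) = k%:E.
Proof.
move=> a0 k0; rewrite /beta1_int; case: eqVneq => // an0.
have {}a0 : 0 < a by rewrite lt_neqAle eq_sym an0.
have mD D : measurable D -> measurable_fun D (fun x : R => (a * (1 - x) `^ (a - 1))%:E).
  by move=> mD; apply: measurable_funTS; exact: measurable_dens.
under eq_integral do rewrite -EFinM.
under eq_integral do rewrite EFinM.
rewrite ge0_integralZl_EFin //; last 2 first.
- by move=> x _; rewrite lee_fin mulr_ge0 ?powR_ge0// ltW.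
- exact: mD.
rewrite -[RHS]mule1; congr (_ * _)%E.
rewrite -integral_itv_bndo_bndc; last exact: mD.
have harm01 n : 0 <= 1 - n.+1%:R^-1 :> R.
  by rewrite subr_ge0 invf_le1 ?ler1n ?ltr0n.
pose F n : set (measurableTypeR R) := `[0%R, 1 - n.+1%:R^-1]%classic.
have mF i : measurable (F i) by rewrite /F; apply: measurable_itv.
have UF : `[0%R, 1%R[%classic = \bigcup_n F n.
  apply/seteqP; split => x /=; rewrite ?in_itv /=.
    move=> /andP[x0 x1]; have y0 : 0 < 1 - x by rewrite subr_gt0.
    (* The integer part n of 1/(1 - x) satisfies n + 1 > 1/(1 - x), hence x <= 1 - 1/(n + 1). *)
    exists (Num.truncn (1 - x)^-1) => //=; rewrite /F /= in_itv /= x0 /=.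
    rewrite lerBrDl -lerBrDr invf_ple ?posrE ?ltr0n// ltW//.
    exact: truncnS_gt.
  move=> [n _]; rewrite /F /= in_itv /= => /andP[-> /= h].
  by apply: le_lt_trans h _; rewrite ltrBlDr ltrDl invr_gt0 ltr0n.
have := @ge0_nondecreasing_set_cvg_integral _ (measurableTypeR R) R F
  (fun x : R => (a * (1 - x) `^ (a - 1))%:E) lam.
rewrite -UF => H.
have h1 : nondecreasing_seq F.
  apply/nondecreasing_seqP => n; rewrite subsetEset => x; rewrite /F /= !in_itv /=.
  move=> /andP[-> /= h]; apply: le_trans h _; rewrite lerD2l lerN2 lef_pV2 ?posrE ?ltr0n//.
  by rewrite ler_nat.
have {}H := H h1 mF (fun i => mD _ (mF i)).
have h4 : forall i x, F i x -> (0 <= (a * (1 - x) `^ (a - 1))%:E)%E.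
  by move=> i x _; rewrite lee_fin mulr_ge0 ?powR_ge0// ltW.
have {}H := H h4.
apply: (cvg_unique _ H) => //.
have -> : (fun i => \int[lam]_(x in F i) (a * (1 - x) `^ (a - 1))%:E)%E =
   (fun i => (1 - (harmonic i : R) `^ a)%:E).
  apply/funext => i; under eq_integral do rewrite EFinM.
  rewrite ge0_integralZl_EFin //; last 3 first.
  - by move=> x _; rewrite lee_fin powR_ge0.
  - have := measurable_dens 1 (a - 1); under eq_fun do rewrite mul1r.
    by move=> h; apply: measurable_funTS.
  - exact: ltW.
  rewrite integral_onem_powR ?gt_eqF// ?harm01 /=; last first.
    by rewrite ltrBlDr ltrDl invr_gt0 ltr0n.
  rewrite subKr -EFinM mulrCA mulfV ?mulr1// gt_eqF.
apply/fine_cvgP; split; first exact: nearW.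
rewrite /comp /= -[X in _ --> X]subr0; apply: cvgB; first exact: cvg_cst.
have /cvg_at_rightP := powR_cvg0 a0; apply; split; last exact: cvg_harmonic.
by move=> n; rewrite /harmonic /= invr_gt0 ltr0n.
Qed.

(** Here [u] stands for (1 - x)^(b - 1) with b = th (1 - q), and [v] for (1 - x)^(th q), so that u v
    is the power in the Beta(1,th) density. The identity compares the densities on the two sides of
    [beta1_int_geom]. *)
Let beta_mix_identity (th q u v : R) : q != 0 ->
  th * (1 - q) * u =
  (1 - q) * (th * (u * v)) + q * (th * (1 - q) * u * (q^-1 * (1 - v))).
Proof. by move=> q0; rewrite (mulrCA q _ (q^-1 * _)) mulVKf //; ring. Qed.

(** The equation for V written for the fraction 1 - V: removing [x] and then the share [y] of the
    rest removes x + (1 - x) y. Tonelli turns the double integral into an integral of [f] against a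
    density, and the claim becomes an identity between densities. The case q = 0 is separated
    because that density contains 1/q. *)
Lemma beta1_int_geom (th q : R) (f : R -> \bar R) : 0 < th -> 0 <= q < 1 ->
  measurable_fun [set: R] f -> (forall x, 0 <= f x)%E ->
  (beta1_int (th * (1 - q)) f = (1 - q)%:E * beta1_int th f +
   q%:E * beta1_int th (fun x => beta1_int (th * (1 - q)) (fun y => f (x + (1 - x) * y)%R)))%E.
Proof.
move=> th0 /andP[q0 q1] mf f0.
have [->|qn0] := eqVneq q 0; first by rewrite subr0 mulr1 mul1e mul0e adde0.
have {qn0}q0 : 0 < q by rewrite lt_neqAle eq_sym qn0.
have [b bE] : exists b, b = th * (1 - q) by eexists.
rewrite -bE; have b0 : 0 < b by rewrite bE mulr_gt0// subr_gt0.
pose D x : \bar R := (f x * (b * (1 - x) `^ (b - 1))%:E)%E.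
have mD : measurable_fun [set: R] D by apply: emeasurable_funM => //; exact: measurable_dens.
have D0 x : (0 <= D x)%E by rewrite mule_ge0// lee_fin mulr_ge0 ?powR_ge0// ltW.
(* [y |-> x + (1 - x) y] carries Beta(1,b) to its law conditioned on [x, 1] *)
have inner x : 0 <= x < 1 -> (beta1_int b (fun y => f (x + (1 - x) * y)%R) =
   ((1 - x) `^ (- b))%:E * \int[lam]_(w in `[x, 1%R]) D w)%E.
  move=> /andP[x0 x1]; have y0 : 0 < 1 - x by rewrite subr_gt0.
  rewrite /beta1_int gt_eqF//.
  transitivity (((1 - x) `^ (1 - b))%:E * \int[lam]_(y in `[0%R, 1%R]) D (x + (1 - x) * y)%R)%E.
    rewrite -ge0_integralZl //=; last 2 first.
    - apply: measurable_funTS; apply: (measurableT_comp mD).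
      exact: (@measurable_affine x (1 - x)).
    - by rewrite lee_fin powR_ge0.
    apply: eq_integral => y; rewrite inE /= in_itv /= => /andP[yy0 yy1].
    rewrite /D muleCA -EFinM; congr (_ * _%:E)%E.
    have -> : 1 - (x + (1 - x) * y) = (1 - x) * (1 - y) by ring.
    rewrite powRM ?subr_ge0 ?(ltW x1)//.
    have -> : 1 - b = - (b - 1) by ring.
    rewrite powRN; field.
    by rewrite gt_eqF // powR_gt0.
  rewrite integral_affine // subrKC muleA -EFinM; congr (_%:E * _)%E.
  rewrite -powR_inv1 ?ltW// -powRD; first by congr (_ `^ _); ring.
  by apply/implyP => _; rewrite gt_eqF.
(* The Beta(1,th) density times the factor (1 - x)^(- b) from [inner]; the exponent is th - 1 - th
   (1 - q) = th q - 1. *)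
pose k (x : R) := th * (1 - x) `^ (th * q - 1).
have mk : measurable_fun [set: R] (EFin \o k) by exact: measurable_dens.
have k0 x : 0 <= k x by rewrite mulr_ge0 ?powR_ge0// ltW.
(* The indicator of the triangle 0 <= x <= w < 1 extends both integrals to the whole line, where
   Tonelli applies. *)
pose I (x w : R) := (((0 <= x <= w) && (w < 1))%:R : R).
have I0 x w : 0 <= I x w by exact: ler0n.
have mI : measurable_fun [set: R * R] (fun z : R * R => (I z.1 z.2)%:E).
  apply/measurable_EFinP.
  apply: (measurableT_comp (f := fun c : bool => (c%:R : R))) => //.
  by apply: measurable_and; [apply: measurable_and|];
    [exact: measurable_fun_ler|exact: measurable_fun_ler|exact: measurable_fun_ltr].
have mkx : measurable_fun [set: R * R] (fun z : R * R => (k z.1)%:E).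
  by apply: (measurableT_comp mk).
have mDw : measurable_fun [set: R * R] (fun z : R * R => D z.2).
  by apply: (measurableT_comp mD).
have mkDI : measurable_fun [set: R * R]
    (fun z : R * R => (k z.1)%:E * (D z.2 * (I z.1 z.2)%:E))%E.
  by apply: emeasurable_funM => //; apply: emeasurable_funM.
have kDI0 (z : R * R) : (0 <= (k z.1)%:E * (D z.2 * (I z.1 z.2)%:E))%E.
  by rewrite mule_ge0 ?lee_fin// mule_ge0 ?lee_fin.
have mI1 x : measurable_fun [set: R] (fun w : R => (I x w)%:E).
  have := measurableT_comp mI (pair1_measurable x); exact.
have mI2 w : measurable_fun [set: R] (fun x : R => (I x w)%:E).
  have := measurableT_comp mI (pair2_measurable w); exact.
have EI1 x : 0 <= x < 1 -> (\int[lam]_w ((k x)%:E * (D w * (I x w)%:E)) =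
    (k x)%:E * \int[lam]_(w in `[x, 1%R]) D w)%E.
  move=> /andP[x0 x1]; rewrite ge0_integralZl//; last 3 first.
  - by apply: emeasurable_funM; [exact: mD|exact: mI1].
  - by move=> w _; rewrite mule_ge0 ?lee_fin.
  - by rewrite lee_fin.
  congr (_ * _)%E; rewrite -integral_itv_bndo_bndc; last exact: measurable_funTS.
  rewrite [RHS]integral_mkcond; apply: eq_integral => w _.
  rewrite patchE mem_setE in_itv /= /I x0 /=.
  by case: ifP => _; rewrite ?mule1 ?mule0.
have stepL : (beta1_int th (fun x => beta1_int b (fun y => f (x + (1 - x) * y)%R)) =
   \int[lam]_x \int[lam]_w ((k x)%:E * (D w * (I x w)%:E)))%E.
  rewrite {1}/beta1_int gt_eqF//.
  have E : {in `[0%R, 1%R[%classic, (fun x => \int[lam]_w ((k x)%:E * (D w * (I x w)%:E)))%E =1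
     (fun x => beta1_int b (fun y => f (x + (1 - x) * y)%R) * (th * (1 - x) `^ (th - 1))%:E)%E}.
    move=> x; rewrite inE /= in_itv /= => x01; rewrite EI1// inner// muleAC -EFinM.
    congr (_%:E * _)%E; rewrite /k mulrCA; congr (_ * _).
    rewrite -powRD; last by apply/implyP => _; rewrite gt_eqF// subr_gt0; case/andP: x01.
    by congr (_ `^ _); rewrite bE; ring.
  rewrite -integral_itv_bndo_bndc; last first.
    apply: eq_measurable_fun; first exact: E.
    apply: measurable_funTS.
    exact: (@measurable_fun_fubini_tonelli_F _ _ _ _ _ lam _ mkDI kDI0).
  transitivity (\int[lam]_(x in `[0%R, 1%R[) \int[lam]_w ((k x)%:E * (D w * (I x w)%:E)))%E.
    by apply: eq_integral => x xI; rewrite E.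
  rewrite integral_mkcond; apply: eq_integral => x _.
  rewrite patchE mem_setE in_itv /=; case: ifPn => // x01; apply/esym.
  apply: integral0_eq => w _; rewrite /I.
  have -> : (0 <= x <= w) && (w < 1) = false.
    apply/negP => /andP[/andP[x0 xw] w1]; move/negP: x01; apply.
    by rewrite x0 (le_lt_trans xw).
  by rewrite !mule0.
pose J (w : R) : R := (0 <= w < 1)%R%:R.
(* Integrating [k] over [0, w] leaves (1 - (1 - w)^(th q)) / q, the extra factor of the mixed
   density. *)
have inner2 w : (\int[lam]_x ((k x)%:E * (D w * (I x w)%:E)) =
   D w * (J w * (q^-1 * (1 - (1 - w) `^ (th * q))))%:E)%E.
  have [w01|w01] := boolP (0 <= w < 1); last first.
    rewrite /J (negbTE w01) mul0r mule0 integral0_eq // => x _; rewrite /I.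
    have -> : (0 <= x <= w) && (w < 1) = false.
      apply/negP => /andP[/andP[x0 xw] w1]; move/negP: w01; apply.
      by rewrite w1 (le_trans x0).
    by rewrite !mule0.
  under eq_integral do rewrite muleCA.
  rewrite ge0_integralZl//; last 2 first.
  - by apply: emeasurable_funM; [exact: mk|exact: mI2].
  - by move=> x _; rewrite mule_ge0 ?lee_fin.
  congr (_ * _)%E; rewrite /J w01 mul1r.
  transitivity (\int[lam]_(x in `[0%R, w]) (k x)%:E)%E.
    rewrite [RHS]integral_mkcond; apply: eq_integral => x _.
    rewrite patchE mem_setE in_itv /= /I; case/andP: w01 => _ ->; rewrite andbT.
    by case: ifP => _; rewrite ?mule1 ?mule0.
  under eq_integral do rewrite EFinM.
  rewrite ge0_integralZl_EFin //; last 3 first.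
  - by move=> x _; rewrite lee_fin powR_ge0.
  - have := measurable_dens 1 (th * q - 1); under eq_fun do rewrite mul1r.
    by move=> h; apply: measurable_funTS.
  - exact: ltW.
  rewrite integral_onem_powR// ?gt_eqF ?mulr_gt0//.
  by rewrite -EFinM; congr (_%:E); field; rewrite !gt_eqF.
have /= FT := @fubini_tonelli _ _ _ _ R lam lam _ mkDI kDI0.
rewrite stepL FT.
under eq_integral do rewrite /= inner2.
rewrite /beta1_int (gt_eqF b0) (gt_eqF th0).
have md (a c : R) : measurable_fun [set: R] (fun x : R => f x * (a * (1 - x) `^ c)%:E)%E.
  by apply: emeasurable_funM => //; exact: measurable_dens.
rewrite -integral_itv_bndo_bndc; last exact: measurable_funTS.
rewrite -[X in (_ = _ * X + _)%E]integral_itv_bndo_bndc; last exact: measurable_funTS.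
have -> : (\int[lam]_y (D y * (J y * (q^-1 * (1 - (1 - y) `^ (th * q))))%:E) =
  \int[lam]_(y in `[0%R, 1%R[) (D y * (q^-1 * (1 - (1 - y) `^ (th * q)))%:E))%E.
  rewrite [RHS]integral_mkcond; apply: eq_integral => x _.
  rewrite patchE mem_setE in_itv /=.
  by rewrite /J; case: ifP => _; [rewrite mul1r|rewrite mul0r mule0].
have e0 (x : R) : 0 <= x < 1 -> 0 <= q^-1 * (1 - (1 - x) `^ (th * q)).
  move=> /andP[x0 x1]; apply: mulr_ge0; first by rewrite invr_ge0 ltW.
  have p1 : 1 `^ (th * q) = 1 :> R by rewrite powR1.
  rewrite subr_ge0 -[leRHS]p1; apply: ge0_ler_powR; rewrite ?nnegrE.
  - by rewrite mulr_ge0 ?ltW.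
  - by rewrite subr_ge0 ltW.
  - exact: ler01.
  - by rewrite gerBl.
have me : measurable_fun [set: R] (fun x : R => D x * (q^-1 * (1 - (1 - x) `^ (th * q)))%:E)%E.
  apply: emeasurable_funM; first exact: mD.
  apply/measurable_EFinP; apply: measurable_funM; first exact: measurable_cst.
  apply: measurable_funB; first exact: measurable_cst.
  apply: (@measurableT_comp _ _ _ _ _ _ (@powR R ^~ (th * q))); first exact: measurable_powR.
  by apply: measurable_funB; [exact: measurable_cst|exact: measurable_id].
apply: ge0_integral_lin.
- exact: measurable_itv.
- by rewrite subr_ge0 ltW.
- exact: ltW.
- by apply: measurable_funTS; exact: md.
- by apply: measurable_funTS; exact: me.
- move=> x _; apply: mule_ge0; first exact: f0.
  by rewrite lee_fin; apply: mulr_ge0; [exact: ltW|exact: powR_ge0].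
- move=> x; rewrite /= in_itv /= => x01.
  by apply: mule_ge0; [exact: D0|rewrite lee_fin; exact: e0].
move=> x; rewrite /= in_itv /= => x01; have /andP[x0 x1] := x01.
have d1 : 0 <= th * (1 - x) `^ (th - 1) by apply: mulr_ge0; [exact: ltW|exact: powR_ge0].
have d2 : 0 <= b * (1 - x) `^ (b - 1) by apply: mulr_ge0; [exact: ltW|exact: powR_ge0].
have q10 : 0 <= 1 - q by rewrite subr_ge0 ltW.
have q0' := ltW q0.
rewrite /D -muleA -EFinM !(muleCA _ (f x)) -!EFinM -ge0_muleDr; last 2 first.
- by rewrite lee_fin; apply: mulr_ge0; [exact: q10|exact: d1].
- by rewrite lee_fin; apply: mulr_ge0; [exact: q0'|apply: mulr_ge0; [exact: d2|exact: e0]].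
rewrite -EFinD; congr (_ * _%:E)%E.
have x10 : 1 - x != 0 by apply: lt0r_neq0; rewrite subr_gt0.
have -> : th - 1 = (b - 1) + th * q by rewrite bE; ring.
rewrite [X in _ = _ * (_ * X) + _]powRD; last by rewrite x10 implybT.
rewrite bE. apply: beta_mix_identity; exact: lt0r_neq0.
Qed.

End Beta.

(** * Iterated Beta integrals: linearity and measurability *)

Section IteratedBeta.
Context {R : realType}.
Local Notation lam := (@lebesgue_measure R).
Implicit Types (F G H : seq R -> \bar R).

Definition unit_itv (x : R) := 0 <= x <= 1.

Lemma eq_beta1_int (a : R) f g : (forall x, unit_itv x -> f x = g x) ->
  beta1_int a f = beta1_int a g.
Proof.
move=> fg; rewrite /beta1_int; case: ifP => _.
  by apply: fg; rewrite /unit_itv ler01 lexx.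
by apply: eq_integral => x; rewrite inE /= in_itv /= => /fg ->.
Qed.

Lemma beta1_int_lin (a c e : R) (f g h : R -> \bar R) :
  0 <= a -> 0 <= c -> 0 <= e ->
  measurable_fun [set: R] g -> measurable_fun [set: R] h ->
  (forall x, 0 <= g x)%E -> (forall x, 0 <= h x)%E ->
  (forall x, unit_itv x -> f x = c%:E * g x + e%:E * h x)%E ->
  (beta1_int a f = c%:E * beta1_int a g + e%:E * beta1_int a h)%E.
Proof.
move=> a0 c0 e0 mg mh g0 h0 /eq_beta1_int ->.
rewrite /beta1_int; case: ifP => // _.
have d0 (x : R) : 0 <= a * (1 - x) `^ (a - 1) by rewrite mulr_ge0 ?powR_ge0.
have md : measurable_fun [set: R] (fun x : R => (a * (1 - x) `^ (a - 1))%:E).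
  exact: measurable_onem_powR.
apply: ge0_integral_lin => //.
- by apply: measurable_funTS; apply: emeasurable_funM.
- by apply: measurable_funTS; apply: emeasurable_funM.
- by move=> x _; rewrite mule_ge0 ?lee_fin.
- by move=> x _; rewrite mule_ge0 ?lee_fin.
by move=> x _; rewrite ge0_muleDl ?mule_ge0 ?lee_fin// !muleA.
Qed.

Lemma le_beta1_int (a : R) (f g : R -> \bar R) : 0 <= a ->
  measurable_fun [set: R] f -> measurable_fun [set: R] g ->
  (forall x, 0 <= f x)%E -> (forall x, unit_itv x -> f x <= g x)%E ->
  (beta1_int a f <= beta1_int a g)%E.
Proof.
move=> a0 mf mg f0 fg; rewrite /beta1_int; case: ifP => // _.
  by apply: fg; rewrite /unit_itv ler01 lexx.
have d0 (x : R) : 0 <= a * (1 - x) `^ (a - 1) by rewrite mulr_ge0 ?powR_ge0.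
have md : measurable_fun [set: R] (fun x : R => (a * (1 - x) `^ (a - 1))%:E).
  exact: measurable_onem_powR.
apply: ge0_le_integral => //.
- by move=> x _; rewrite mule_ge0 ?lee_fin.
- by apply: measurable_funTS; apply: emeasurable_funM.
- by apply: measurable_funTS; apply: emeasurable_funM.
- move=> x; rewrite /= in_itv /= => x01; apply: lee_wpmul2r; last exact: fg.
  by rewrite lee_fin.
Qed.

(** The integrand a (1 - x)^a is a / (a + 1) times the Beta(1,a+1) density, whose total mass is
    1. *)
Lemma beta1_int_onem (a : R) : 0 < a ->
  beta1_int a (fun x => (1 - x)%:E) = (a / (a + 1))%:E.
Proof.
move=> a0; have a10 : 0 < a + 1 by exact: addr_gt0.
transitivity ((a / (a + 1))%:E * beta1_int (a + 1) (fun=> 1))%E; last first.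
  by rewrite beta1_int_cst ?mule1// ltW.
have mp : measurable_fun [set: R] (fun x : R => 1 * ((a + 1) * (1 - x) `^ (a + 1 - 1))%:E)%E.
  by apply: emeasurable_funM => //; apply: measurable_onem_powR.
rewrite /beta1_int !gt_eqF// -ge0_integralZl//; last 3 first.
- exact: measurable_funTS.
- by move=> x _; rewrite mul1e lee_fin mulr_ge0 ?powR_ge0// ltW.
- by rewrite lee_fin divr_ge0// ltW.
apply: eq_integral => x; rewrite inE /= in_itv /= => /andP[_ x1].
rewrite mul1e -!EFinM; congr (_%:E); rewrite addrK mulrCA mulr_powRB1 ?subr_ge0//.
by field; rewrite gt_eqF.
Qed.

(** Integrates a function where [beta1_prod] measures a set: linear combinations and mean values are
    needed besides indicators. *)
Fixpoint beta1_iter (al : seq R) F : \bar R :=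
  match al with
  | [::] => F [::]
  | a :: al' => beta1_int a (fun x => beta1_iter al' (fun s => F (x :: s)))
  end.

Lemma beta1_prodE al (A : set (seq R)) :
  beta1_prod al A = beta1_iter al (fun s => (\1_A s)%:E).
Proof.
elim: al A => [//|a al ih] A /=; apply: eq_beta1_int => x _.
by rewrite ih.
Qed.

Lemma eq_beta1_iter al F G :
  (forall s, size s = size al -> all unit_itv s -> F s = G s) ->
  beta1_iter al F = beta1_iter al G.
Proof.
elim: al F G => [|a al ih] F G FG /=; first exact: FG.
apply: eq_beta1_int => x x01; apply: ih => s sz s01; apply: FG => /=.
  by rewrite sz.
by rewrite x01.
Qed.

Lemma beta1_iter_cat al bl F :
  beta1_iter (al ++ bl) F = beta1_iter al (fun s => beta1_iter bl (fun u => F (s ++ u))).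
Proof.
by elim: al F => [//|a al ih] F /=; apply: eq_beta1_int => x _; rewrite ih.
Qed.

Definition nnegs (al : seq R) := all (fun a => 0 <= a) al.

Lemma beta1_iter_ge0 al F : nnegs al -> (forall s, 0 <= F s)%E ->
  (0 <= beta1_iter al F)%E.
Proof.
elim: al F => [|a al ih] F //= /andP[a0 al0] F0.
by apply: beta1_int_ge0 => // x _; exact: ih.
Qed.

Lemma beta1_iter_cst al (k : R) : nnegs al -> 0 <= k ->
  beta1_iter al (fun=> k%:E) = k%:E.
Proof.
elim: al => [|a al ih] //= /andP[a0 al0] k0.
by under eq_beta1_int do rewrite ih//; rewrite beta1_int_cst.
Qed.

(** [F] acts on sequences of every length; measurability is stated one length at a time, through
    tuples. *)
Definition seq_measurable n F := measurable_fun [set: n.-tuple R] (fun s : n.-tuple R => F s).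

Lemma measurable_nth n i : measurable_fun [set: n.-tuple R] (fun s : n.-tuple R => (tval s)`_i).
Proof.
have [iltn|nlei] := ltnP i n.
  rewrite (_ : (fun s => _) = (fun s : n.-tuple R => tnth s (Ordinal iltn))).
    exact: measurable_tnth.
  by apply/funext => s; rewrite (tnth_nth 0).
rewrite (_ : (fun s => _) = cst 0) //; apply/funext => s.
by rewrite nth_default// size_tuple.
Qed.

Lemma measurable_rcons n d (T : measurableType d) (f : T -> n.-tuple R) (g : T -> R) :
  measurable_fun [set: T] f -> measurable_fun [set: T] g ->
  measurable_fun [set: T] (fun t => [tuple of rcons (f t) (g t)]).
Proof.
move=> mf mg; apply/measurable_fun_tnthP => i.
have [iltn|nlei] := ltnP i n.
  rewrite (_ : _ \o _ = (fun s : n.-tuple R => (tval s)`_i) \o f).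
    by apply: measurableT_comp => //; exact: measurable_nth.
  by apply/funext => t /=; rewrite (tnth_nth 0) /= nth_rcons size_tuple iltn.
rewrite (_ : _ \o _ = g) //; apply/funext => t /=.
have e : i = n :> nat by apply/eqP; rewrite eqn_leq nlei -ltnS ltn_ord.
by rewrite (tnth_nth 0) /= nth_rcons size_tuple e ltnn eqxx.
Qed.

Lemma seq_measurable_rcons n F (s : n.-tuple R) : seq_measurable n.+1 F ->
  measurable_fun [set: R] (fun x => F (rcons s x)).
Proof.
move=> mF; have := measurableT_comp mF (measurable_rcons (measurable_cst s) (@measurable_id _
  R setT)).
exact.
Qed.

(** Measurability of a partial integral is part of Tonelli's theorem once the indicator of [0, 1]
    moves into the integrand. At a = 0 the integral is evaluation at 1. *)
Lemma seq_measurable_beta1_int n (a : R) F : 0 <= a -> (forall s, 0 <= F s)%E ->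
  seq_measurable n.+1 F ->
  seq_measurable n (fun s => beta1_int a (fun x => F (rcons s x))).
Proof.
move=> a0 F0 mF; rewrite /seq_measurable /beta1_int; case: (a == 0).
  have := measurableT_comp mF (measurable_rcons (@measurable_id _ (n.-tuple R) setT)
    (measurable_cst (1 : R))).
  exact.
pose g (z : n.-tuple R * measurableTypeR R) : \bar R :=
  (F (rcons z.1 z.2) * (a * (1 - z.2) `^ (a - 1))%:E * (\1_(`[0%R, 1%R]%classic : set R)
    z.2)%:E)%E.
have mg : measurable_fun setT g.
  apply: emeasurable_funM; first apply: emeasurable_funM.
  - have := measurableT_comp mF (measurable_rcons (@measurable_fst _ _ (n.-tuple R)
    (measurableTypeR R)) (@measurable_snd _ _ (n.-tuple R) (measurableTypeR R))).
    exact.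
  - have := measurableT_comp (@measurable_onem_powR R a (a - 1)) (@measurable_snd _ _
    (n.-tuple R) (measurableTypeR R)).
    exact.
  - apply/measurable_EFinP.
    have := measurableT_comp (@measurable_indic _ (measurableTypeR R) R setT _
      (measurable_itv `[0%R, 1%R])) (@measurable_snd _ _ (n.-tuple R) (measurableTypeR R)).
    exact.
have g0 z : (0 <= g z)%E.
  by rewrite mule_ge0 ?lee_fin// mule_ge0 ?lee_fin// mulr_ge0 ?powR_ge0.
have := @measurable_fun_fubini_tonelli_F _ _ _ _ R lam g mg g0.
congr (measurable_fun _ _); apply/funext => s.
rewrite [RHS]integral_mkcond; apply: eq_integral => x _.
rewrite patchE /g /= indicE.
by case: ifP => _; rewrite ?mule1 ?mule0.
Qed.

(** The free prefix [s] makes the induction on [al] work: the next coordinate joins the prefix as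
    its last entry and is then integrated out. *)
Lemma seq_measurable_beta1_iter n al F : nnegs al -> (forall s, 0 <= F s)%E ->
  seq_measurable (n + size al) F ->
  seq_measurable n (fun s => beta1_iter al (fun u => F (s ++ u))).
Proof.
elim: al n => [|a al ih] n /=.
  move=> _ _; rewrite addn0; congr (measurable_fun _ _).
  by apply/funext => s; rewrite cats0.
move=> /andP[a0 al0] F0; rewrite addnS -addSn => mF.
have := seq_measurable_beta1_int a0 _ (ih _ al0 F0 mF).
move=> /(_ (fun s => beta1_iter_ge0 al0 (fun u => F0 _))).
congr (measurable_fun _ _); apply/funext => s; apply: eq_beta1_int => x _.
by under eq_fun do rewrite cat_rcons.
Qed.

Lemma measurable_beta1_iter_cons al F : nnegs al -> (forall s, 0 <= F s)%E ->
  seq_measurable (size al).+1 F ->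
  measurable_fun [set: R] (fun x => beta1_iter al (fun s => F (x :: s))).
Proof.
move=> al0 F0; rewrite -add1n => mF.
have := seq_measurable_rcons [tuple] (seq_measurable_beta1_iter al0 F0 mF).
exact.
Qed.

Lemma seq_measurable_cons n (x : R) F : seq_measurable n.+1 F ->
  seq_measurable n (fun s => F (x :: s)).
Proof.
move=> mF; have := measurableT_comp mF (measurable_cons (measurable_cst x) (@measurable_id _
  (n.-tuple R) setT)).
exact.
Qed.

Lemma beta1_iter_lin al (c e : R) F G H : nnegs al -> 0 <= c -> 0 <= e ->
  seq_measurable (size al) G -> seq_measurable (size al) H ->
  (forall s, 0 <= G s)%E -> (forall s, 0 <= H s)%E ->
  (forall s, size s = size al -> all unit_itv s -> F s = c%:E * G s + e%:E * H s)%E ->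
  (beta1_iter al F = c%:E * beta1_iter al G + e%:E * beta1_iter al H)%E.
Proof.
move=> + c0 e0; elim: al F G H => [|a al ih] F G H /=.
  by move=> _ _ _ _ _; apply.
move=> /andP[a0 al0] mG mH G0 H0 FGH; apply: beta1_int_lin => //.
- exact: measurable_beta1_iter_cons.
- exact: measurable_beta1_iter_cons.
- by move=> x; apply: beta1_iter_ge0.
- by move=> x; apply: beta1_iter_ge0.
move=> x x01; apply: ih => //.
- exact: seq_measurable_cons mG.
- exact: seq_measurable_cons mH.
- by move=> s sz s01; apply: FGH; rewrite /= ?sz// x01.
Qed.

End IteratedBeta.

(** * Switch times, states and clumps along a path *)

Section Blocks.
Context {R : realType} {X : countType}.
Implicit Types (t : nat -> X) (p : nat -> R).

(** The number of switches of [t] up to time [i], hence the index of the clump that letter [i]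
    joins. It is total and read off a finite word, and the optional switch times are re-expressed
    through it below. *)
Fixpoint blk t (i : nat) : nat :=
  match i with 0 => 0 | i'.+1 => blk t i' + (t i'.+1 != t i') end%N.

Lemma blkS t i : blk t i.+1 = (blk t i + (t i.+1 != t i))%N.
Proof. by []. Qed.

Lemma leq_blk t i k : (i <= k)%N -> (blk t i <= blk t k)%N.
Proof.
move=> /subnKC <-; elim: (k - i)%N => [|l ih]; first by rewrite addn0.
by rewrite addnS blkS; apply: leq_trans ih _; exact: leq_addr.
Qed.

(** The block index never decreases and grows at each switch, so equal indices leave no switch in
    between. *)
Lemma blk_inj_state t i k : blk t i = blk t k -> t i = t k.
Proof.
wlog ik : i k / (i <= k)%N.
  by move=> h; have [/h//|/ltnW ki /esym/(h _ _ ki)] := leqP i k.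
move: ik => /subnKC <-; elim: (k - i)%N => [|l ih]; first by rewrite addn0.
rewrite addnS blkS => e.
have := leq_blk t (leq_addr l i).
case: eqP e => [-> /= e _|_ /= e]; last by lia.
by apply: ih; rewrite addn0 in e.
Qed.

Lemma eq_blk t t' N : (forall i, (i <= N)%N -> t i = t' i) ->
  forall i, (i <= N)%N -> blk t i = blk t' i.
Proof.
move=> h; elim=> [//|i ih] iN.
by rewrite !blkS ih ?(ltnW iN)// !h ?(ltnW iN).
Qed.

Lemma blk_const t N : (forall i, (N <= i)%N -> t i = t N) ->
  forall i, (N <= i)%N -> blk t i = blk t N.
Proof.
move=> h i /subnKC <-; elim: (i - N)%N => [|l ih]; first by rewrite addn0.
by rewrite addnS blkS ih !h ?eqxx ?addn0//; lia.
Qed.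

Lemma const_blk t N : (forall i, (N <= i)%N -> blk t i = blk t N) ->
  forall i, (N <= i)%N -> t i = t N.
Proof. by move=> h i Ni; apply: blk_inj_state; exact: h. Qed.

(** The block index starts at 0 and rises by at most one per step, so it skips no value. *)
Lemma blk_ivt t N j : (j <= blk t N)%N -> exists2 i, (i <= N)%N & blk t i = j.
Proof.
elim: N => [|N ih]; first by rewrite leqn0 => /eqP ->; exists 0%N.
rewrite blkS; have [/ih[i iN ij] _|lt le] := leqP j (blk t N).
  by exists i => //; exact: leqW.
by exists N.+1 => //; rewrite blkS; move: lt le; case: eqP => _ /=; lia.
Qed.

(** From the start [v] of block [j] the index stays [j] until the next change of state, which is
    therefore the first time in block [j.+1]; without such a change the index never exceeds [j]. *)
Lemma switchP t j :
  match switch t j with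
  | Some v => blk t v = j /\ forall i, (i < v)%N -> (blk t i < j)%N
  | None => forall i, (blk t i < j)%N
  end.
Proof.
elim: j => [|j /=]; first by [].
case: (switch t j) => [v [vj vlt]|h]; last by move=> i; exact: ltnW (h i).
rewrite /next_switch; case: pselect => [ex|nex].
  case: ex_minnP => w /andP[vw tw] wmin.
  have cst i : (v <= i < w)%N -> blk t i = j.
    move=> /andP[vi]; move: (vi) => /subnKC <-.
    elim: (i - v)%N => [|l ih] lw; first by rewrite addn0.
    rewrite addnS blkS ih; last by lia.
    case: eqP => [_|ne]; first by rewrite addn0.
    have := wmin (v + l).+1; rewrite ltnS leq_addr /=.
    by move/eqP : ne => -> /(_ isT); lia.
  split; last first.
    move=> i iw; have [vi|iv] := leqP v i; first by rewrite cst ?vi.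
    by apply: leqW; exact: vlt.
  case: w vw tw cst {wmin} => // w vw /= tw cst.
  by rewrite tw cst ?addn1 //; lia.
have cst i : (v <= i)%N -> blk t i = j.
  move/subnKC <-; elim: (i - v)%N => [|l ih]; first by rewrite addn0.
  rewrite addnS blkS ih; case: eqP => [_|/eqP ne]; first by rewrite addn0.
  by exfalso; apply: nex; exists (v + l).+1; rewrite ltnS leq_addr.
move=> i; have [vi|iv] := leqP v i; first by rewrite cst.
by apply: leqW; exact: vlt.
Qed.

Let switch_stateS t j : switch_state t j.+1 =
  match switch t j.+1 with Some v => t v | None => switch_state t j end.
Proof. by []. Qed.

Lemma switch_state_blk t i : switch_state t (blk t i) = t i.
Proof.
have := switchP t (blk t i); case e : (blk t i) => [|j].
  by move=> _ /=; apply: blk_inj_state; rewrite e.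
rewrite switch_stateS; case: (switch t j.+1) => [v [vj _]|/(_ i)].
  by apply: blk_inj_state; rewrite vj.
by rewrite e ltnn.
Qed.

(** Past the last block the switch times are infinite and [switch_state] keeps repeating the state
    before, which is the absorbing one. *)
Lemma switch_state_const t N j : (forall i, (N <= i)%N -> t i = t N) ->
  (blk t N <= j)%N -> switch_state t j = t N.
Proof.
move=> cst; elim: j => [|j ih] le.
  by move: le; rewrite leqn0 => /eqP e; rewrite -(switch_state_blk t N) e.
have [e|ne] := eqVneq (blk t N) j.+1; first by rewrite -e switch_state_blk.
have lt : (blk t N < j.+1)%N by rewrite ltn_neqAle ne le.
rewrite switch_stateS; have := switchP t j.+1.
case: (switch t j.+1) => [v [vj vlt]|_].
  have [Nv|vN] := leqP N v; first by exact: cst.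
  by have := leq_blk t (ltnW vN); rewrite vj leqNgt lt.
exact: ih.
Qed.

(** Only countable quantifiers over letters and block indices occur on the right, which is what
    measurability needs. The second alternative is absorption before block [j]. *)
Lemma switch_stateP t j z : switch_state t j = z <->
  exists i, t i = z /\ (blk t i = j \/
     ((blk t i < j)%N /\ forall k, (i <= k)%N -> t k = z)).
Proof.
split=> [<-|[i [<- [<-|[lt cst]]]]]; last 2 first.
- exact: switch_state_blk.
- by apply: switch_state_const => //; exact: ltnW.
have [[i ij]|nex] := pselect (exists i, blk t i = j).
  by exists i; rewrite -ij switch_state_blk; split=> //; left.
have lt i : (blk t i < j)%N.
  rewrite ltnNge; apply/negP => /blk_ivt[k _ kj]; apply: nex; by exists k.
(* If block [j] is never reached, the block index is bounded and attains its maximum at some [N];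
   from there on it is constant. *)
have [N cst] : exists N, forall i, (N <= i)%N -> blk t i = blk t N.
  have ex0 : exists m, `[< exists i, blk t i = m >] by exists 0%N; apply/asboolP; exists 0%N.
  have bd m : `[< exists i, blk t i = m >] -> (m <= j)%N.
    by move=> /asboolP[i <-]; exact: ltnW.
  case: (ex_maxnP ex0 bd) => m /asboolP[N Nm] mmax.
  exists N => i Ni; apply/eqP; rewrite eqn_leq (leq_blk t Ni) andbT Nm.
  by apply: mmax; apply/asboolP; exists i.
have cst' := const_blk cst.
exists N; rewrite (switch_state_const cst'); last exact: ltnW.
by split=> //; right.
Qed.

(** One formula covers the three cases of [clump]: the partial sums are eventually constant for a
    finished block, run on from the start of the block for the last one, and vanish for a block
    never reached. *)
Lemma clumpE t p j :
  clump t p j = limn (fun m => \sum_(0 <= i < m | blk t i == j) p i).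
Proof.
rewrite /clump; have := switchP t j; have := switchP t j.+1.
case E : (switch t j) => [v|] hS h; last first.
  rewrite (_ : (fun m => _) = cst 0) ?lim_cst//; apply/funext => m.
  by rewrite big1// => i /eqP e; have := h i; rewrite e ltnn.
have [vj vlt] := h; case: (switch t j.+1) hS => [w [wj wlt]|lt].
  apply/esym/cvg_lim => //; apply: cvg_near_cst; near=> m.
  have wm : (w <= m)%N by near: m; exact: nbhs_infty_ge.
  have vw : (v <= w)%N.
    by rewrite leqNgt; apply/negP => /vlt; rewrite wj ltnNge leqnSn.
  rewrite (big_cat_nat (leq0n w) wm) /= (big_cat_nat (leq0n v) vw) /=.
  rewrite [X in X + _ + _](_ : _ = 0) ?add0r; last first.
    by rewrite big_nat_cond big1// => i /andP[/vlt lt /eqP e]; rewrite e ltnn in lt.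
  rewrite [X in _ + X](_ : _ = 0) ?addr0; last first.
    rewrite big_nat_cond big1// => i /andP[/andP[wi _] /eqP e]; have := leq_blk t wi.
    by rewrite wj e ltnn.
  rewrite big_nat_cond [RHS]big_nat_cond; apply: eq_bigl => i.
  case vi : (v <= i)%N => //=; case iw: (i < w)%N => //=.
  apply/eqP; have := leq_blk t vi; rewrite vj => ?.
  by have := wlt _ iw; lia.
congr (limn _); apply/funext => m.
have [vm|mv] := leqP v m; last first.
  rewrite big_geq ?(ltnW mv) // big_nat_cond big1// => i.
  move=> /andP[/andP[_ im] /eqP e].
  by have := vlt i (ltn_trans im mv); rewrite e ltnn.
rewrite (big_cat_nat (leq0n v) vm) /= [X in _ = X + _](_ : _ = 0) ?add0r; last first.
  by rewrite big_nat_cond big1// => i /andP[/andP[_ /vlt lt'] /eqP e]; rewrite e ltnn in lt'.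
rewrite big_nat_cond [RHS]big_nat_cond; apply: eq_bigl => i.
case vi : (v <= i)%N => //=; case im: (i < m)%N => //=.
apply/esym/eqP; have := leq_blk t vi; rewrite vj => ?.
by have := lt i; lia.
Unshelve. all: by end_near. Qed.

End Blocks.

(** * Stick masses summed over labelled blocks *)

Section ClumpSums.
Context {R : realType}.
Implicit Types (F G H : seq R -> \bar R).

Lemma le_beta1_iter (al : seq R) F G : nnegs al ->
  seq_measurable (size al) F -> seq_measurable (size al) G ->
  (forall s, 0 <= F s)%E -> (forall s, 0 <= G s)%E ->
  (forall s, size s = size al -> all unit_itv s -> F s <= G s)%E ->
  (beta1_iter al F <= beta1_iter al G)%E.
Proof.
elim: al F G => [|a al ih] F G /=; first by move=> _ _ _ _ _; apply.
move=> /andP[a0 al0] mF mG F0 G0 FG; apply: le_beta1_int => //.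
- exact: measurable_beta1_iter_cons.
- exact: measurable_beta1_iter_cons.
- by move=> x; apply: beta1_iter_ge0.
move=> x x01; apply: ih => //.
- exact: seq_measurable_cons mF.
- exact: seq_measurable_cons mG.
- by move=> s sz s01; apply: FG; rewrite /= ?sz// x01.
Qed.

Lemma beta1_iterZ (al : seq R) (c : R) F G : nnegs al -> 0 <= c ->
  seq_measurable (size al) G -> (forall s, 0 <= G s)%E ->
  (forall s, size s = size al -> all unit_itv s -> F s = c%:E * G s)%E ->
  (beta1_iter al F = c%:E * beta1_iter al G)%E.
Proof.
move=> al0 c0 mG G0 FG.
rewrite (@beta1_iter_lin _ al c 0 F G G)// ?mul0e ?adde0// => s sz s01.
by rewrite mul0e adde0; exact: FG.
Qed.

(** [beta1_int_geom] in the coordinate after the prefix [al], for a function [G] that sees the two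
    fractions [x] and [y] only through the merged fraction x + (1 - x) y. *)
Lemma beta1_iter_geom (al bl : seq R) (th q : R) F G :
  nnegs al -> nnegs bl -> 0 < th -> 0 <= q < 1 ->
  (forall s, 0 <= F s)%E -> (forall s, 0 <= G s)%E ->
  seq_measurable (size al + (size bl).+1) F ->
  seq_measurable (size al + (size bl).+2) G ->
  (forall s x y u, size s = size al ->
    G (s ++ [:: x, y & u]) = F (s ++ (x + (1 - x) * y) :: u)) ->
  (beta1_iter (al ++ (th * (1 - q))%R :: bl) F =
   (1 - q)%:E * beta1_iter (al ++ th :: bl) F +
   q%:E * beta1_iter (al ++ [:: th, (th * (1 - q))%R & bl]) G)%E.
Proof.
move=> al0 bl0 th0 q01; have /andP[q0 q1] := q01 => F0 G0 mF mG GF; rewrite !beta1_iter_cat.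
have b0 : 0 <= th * (1 - q) by rewrite mulr_ge0 ?subr_ge0 ?ltW.
have thbl0 : nnegs (th :: bl) by rewrite /= ltW.
have thbbl0 : nnegs [:: th, th * (1 - q) & bl] by rewrite /= ltW// b0.
apply: beta1_iter_lin => //.
- by rewrite subr_ge0 ltW.
- exact: (@seq_measurable_beta1_iter _ _ (th :: bl)).
- exact: (@seq_measurable_beta1_iter _ _ [:: th, th * (1 - q) & bl]).
- by move=> s; apply: (@beta1_iter_ge0 _ (th :: bl)).
- by move=> s; apply: (@beta1_iter_ge0 _ [:: th, th * (1 - q) & bl]).
move=> s sz _ /=.
have mf : measurable_fun [set: R] (fun x => beta1_iter bl (fun u => F (s ++ x :: u))).
  move/eqP : sz => sz.
  have mF' : seq_measurable (size al).+1 (fun s => beta1_iter bl (fun u => F (s ++ u))).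
    by apply: seq_measurable_beta1_iter => //; rewrite addSnnS.
  have := seq_measurable_rcons (Tuple sz) mF'.
  congr (measurable_fun _ _); apply/funext => x /=.
  by under eq_fun do rewrite cat_rcons.
have E : beta1_int th (fun x => beta1_int (th * (1 - q)) (fun y =>
      beta1_iter bl (fun u => G (s ++ [:: x, y & u])))) =
    beta1_int th (fun x => beta1_int (th * (1 - q)) (fun y =>
      beta1_iter bl (fun u => F (s ++ (x + (1 - x) * y) :: u)))).
  apply: eq_beta1_int => x _; apply: eq_beta1_int => y _.
  by apply: eq_beta1_iter => u _ _; rewrite GF.
rewrite E; apply: (beta1_int_geom th0 q01 mf) => x.
exact: beta1_iter_ge0.
Qed.

Definition residual (s : seq R) := \prod_(x <- s) (1 - x).

Lemma residual_unit s : all unit_itv s -> 0 <= residual s <= 1.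
Proof.
elim: s => [|x s ih] /=; first by rewrite /residual big_nil ler01 lexx.
move=> /andP[/andP[x0 x1] /ih /andP[r0 r1]]; rewrite /residual big_cons.
rewrite mulr_ge0 ?subr_ge0//= mulr_ile1 ?subr_ge0//.
by rewrite gerBl.
Qed.

Lemma measurable_residual n : measurable_fun [set: n.-tuple R] (fun s : n.-tuple R =>
  residual s).
Proof.
rewrite (_ : (fun s => _) = fun s : n.-tuple R => \prod_(i <- iota 0 n) (1 - (tval s)`_i)).
  elim: (iota 0 n) => [|i l ih].
    by under eq_fun do rewrite big_nil; exact: measurable_cst.
  under eq_fun do rewrite big_cons; apply: measurable_funM => //.
  by apply: measurable_funB => //; exact: measurable_nth.
apply/funext => s; rewrite /residual (big_nth 0) size_tuple.
by rewrite /index_iota subn0.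
Qed.

Lemma seq_measurable_normr_residual n : seq_measurable n (fun s => `|residual s|%:E).
Proof.
apply/measurable_EFinP; apply: measurableT_comp => //; exact: measurable_residual.
Qed.

Lemma nnegs_nseq n (th : R) : 0 <= th -> nnegs (nseq n th).
Proof. by move=> th0; rewrite /nnegs all_nseq th0 orbT. Qed.

(** By independence the mean is the product of [n] means of 1 - X, each equal to th / (th + 1). The
    absolute value keeps the integrand nonnegative off the unit cube and changes nothing on it. *)
Lemma beta1_iter_residual n (th : R) : 0 < th ->
  beta1_iter (nseq n th) (fun s => `|residual s|%:E) = ((th / (th + 1)) ^+ n)%:E.
Proof.
move=> th0; elim: n => [|n ih].
  by rewrite /= /residual big_nil normr1.
have r0 : 0 <= th / (th + 1) by rewrite divr_ge0// ltW// addr_gt0.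
have E x : unit_itv x -> (beta1_iter (nseq n th) (fun s => `|residual (x :: s)|%:E) =
    ((th / (th + 1)) ^+ n)%:E * (`|1 - x|)%:E + 0%:E * (`|1 - x|)%:E)%E.
  move=> /andP[_ x1]; rewrite mul0e adde0 -ih muleC.
  apply: beta1_iterZ => //.
  - exact/nnegs_nseq/ltW.
  - exact: seq_measurable_normr_residual.
  - by move=> s _ _; rewrite /residual big_cons normrM.
have m1 : measurable_fun [set: R] (fun x : R => (`|1 - x|)%:E).
  by apply/measurable_EFinP; apply: measurableT_comp => //; exact: measurable_funB.
rewrite /= (beta1_int_lin (ltW th0) _ _ m1 m1 _ _ E)// ?exprn_ge0// mul0e adde0.
rewrite (@eq_beta1_int _ _ _ (fun x => (1 - x)%:E)); last first.
  by move=> x /andP[_ x1]; rewrite ger0_norm// subr_ge0.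
by rewrite beta1_int_onem// -EFinM exprSr.
Qed.

Lemma stick_cons0 (x : R) s : stick (x :: s) 0 = x.
Proof. by rewrite /stick big_ord0 mulr1. Qed.

Lemma stick_consS (x : R) s i : stick (x :: s) i.+1 = (1 - x) * stick s i.
Proof. by rewrite /stick /= big_ord_recl /= mulrCA. Qed.

Lemma stick_cat (s u : seq R) i : (i < size s)%N -> stick (s ++ u) i = stick s i.
Proof.
elim: s i => [//|x s ih] [|i] /=; first by rewrite !stick_cons0.
by rewrite ltnS => /ih; rewrite !stick_consS => ->.
Qed.

Lemma stick_ge0 (s : seq R) i : all unit_itv s -> 0 <= stick s i.
Proof.
elim: s i => [|x s ih] i /=; first by rewrite /stick nth_nil mul0r.
move=> /andP[/andP[x0 x1] s01]; case: i => [|i]; first by rewrite stick_cons0.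
by rewrite stick_consS mulr_ge0 ?subr_ge0 ?ih.
Qed.

Lemma sum_stick (s : seq R) : \sum_(0 <= i < size s) stick s i = 1 - residual s.
Proof.
elim: s => [|x s ih]; first by rewrite big_geq// /residual big_nil subrr.
rewrite big_nat_recl//= stick_cons0.
under eq_bigr do rewrite stick_consS.
by rewrite -mulr_sumr ih /residual big_cons; ring.
Qed.

Lemma measurable_stick n i : measurable_fun [set: n.-tuple R] (fun s : n.-tuple R => stick s i).
Proof.
apply: measurable_funM; first exact: measurable_nth.
rewrite (_ : (fun s => _) = fun s : n.-tuple R => \prod_(j <- iota 0 i) (1 - (tval s)`_j)).
  elim: (iota 0 i) => [|j l ih].
    by under eq_fun do rewrite big_nil; exact: measurable_cst.
  under eq_fun do rewrite big_cons; apply: measurable_funM => //.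
  by apply: measurable_funB => //; exact: measurable_nth.
apply/funext => s; rewrite -(big_mkord xpredT (fun j => 1 - (tval s)`_j)).
by rewrite /index_iota subn0.
Qed.

(** The finite counterpart of [clump] for a stick cut by [u], where [b] assigns a block label to
    each index. *)
Definition clump_sum (b : nat -> nat) (u : seq R) (j : nat) :=
  \sum_(0 <= i < size u | b i == j) stick u i.

Lemma clump_sum_cons b x u j :
  clump_sum b (x :: u) j = (b 0%N == j)%:R * x + (1 - x) * clump_sum (b \o S) u j.
Proof.
rewrite /clump_sum big_mkcond big_nat_recl//= stick_cons0; congr (_ + _).
  by case: eqP => _; rewrite ?mul1r ?mul0r.
rewrite [in RHS]big_mkcond mulr_sumr; apply: eq_bigr => i _ /=.
by case: eqP => _; rewrite ?stick_consS ?mulr0.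
Qed.

(** Breaking off [s] first leaves a stick of length [residual s] for [u], whose labels are shifted
    by [size s]. *)
Lemma clump_sum_cat b s u j :
  clump_sum b (s ++ u) j = clump_sum b s j + residual s * clump_sum (fun i => b (size s +
    i)%N) u j.
Proof.
elim: s b => [|x s ih] b /=.
  by rewrite /residual big_nil mul1r /clump_sum [X in _ = X + _]big_geq// add0r.
by rewrite !clump_sum_cons ih /residual big_cons /=; ring.
Qed.

Lemma clump_sum_nseq1 b k j : clump_sum b (nseq k.+1 1) j = (b 0%N == j)%:R.
Proof. by rewrite /= clump_sum_cons; ring. Qed.

Lemma eq_clump_sum b c u : (forall i, (i < size u)%N -> b i = c i) -> clump_sum b u =1
  clump_sum c u.
Proof.
move=> bc j; rewrite /clump_sum big_nat_cond [RHS]big_nat_cond; apply: eq_bigl => i.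
by case i_lt : (i < size u)%N; rewrite ?andbF//= bc.
Qed.

(** Two consecutive fractions [x], [y] with one label give that block the mass of the single
    fraction x + (1 - x) y, and leave the same rest (1 - x) (1 - y). The labelling [c] is [b] with
    one of the two equal labels dropped. *)
Lemma clump_sum_merge b c s x y u j : b (size s).+1 = b (size s) ->
  (forall i, (i <= size s)%N -> c i = b i) ->
  (forall i, (size s <= i)%N -> c i = b i.+1) ->
  clump_sum b (s ++ [:: x, y & u]) j = clump_sum c (s ++ (x + (1 - x) * y) :: u) j.
Proof.
elim: s b c => [|a s ih] b c /= bS cb cbS.
  rewrite !clump_sum_cons (cb 0%N)//= bS; have -> : c \o S = b \o S \o S.
    by apply/funext => i /=; rewrite cbS.
  by ring.
rewrite !clump_sum_cons cb// (ih _ (c \o S))//=.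
- by move=> i i_le; rewrite cb.
- by move=> i i_le; rewrite cbS.
Qed.

Lemma measurable_clump_sum n b j : measurable_fun [set: n.-tuple R] (fun u : n.-tuple R =>
  clump_sum b u j).
Proof.
rewrite (_ : (fun s => _) = fun s : n.-tuple R => \sum_(i <- iota 0 n) (if b i == j then
  stick s i else 0)).
  elim: (iota 0 n) => [|i l ih].
    by under eq_fun do rewrite big_nil; exact: measurable_cst.
  under eq_fun do rewrite big_cons; apply: measurable_funD => //.
  by case: eqP => _; [exact: measurable_stick|exact: measurable_cst].
by apply/funext => s; rewrite /clump_sum size_tuple big_mkcond /index_iota subn0.
Qed.

Lemma measurable_tup d (T : measurableType d) n (f : nat -> T -> R) :
  (forall j, (j < n)%N -> measurable_fun [set: T] (f j)) ->
  measurable_fun [set: T] (fun t => tup n (f ^~ t)).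
Proof.
move=> mf; apply/measurable_fun_tnthP => j.
rewrite (_ : _ \o _ = f j); first exact: mf.
by apply/funext => t /=; rewrite tnth_mktuple.
Qed.

Lemma seq_measurable_indic k n (A : set (n.-tuple R)) (f : nat -> seq R -> R) :
  measurable A ->
  (forall j, (j < n)%N -> measurable_fun [set: k.-tuple R] (fun s : k.-tuple R => f j s)) ->
  seq_measurable k (fun u => (\1_[set u | A (tup n (f ^~ u))] u)%:E).
Proof.
move=> mA mf; apply/measurable_EFinP.
have mg : measurable_fun [set: k.-tuple R] (fun u : k.-tuple R => tup n (fun j => f j u)).
  exact: (@measurable_tup _ _ n (fun j (u : k.-tuple R) => f j u)).
have := measurableT_comp (@measurable_indic _ _ R setT _ mA) mg; exact.
Qed.

End ClumpSums.

(** * Measurability of the clumped process *)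

Section MeasurableSets.
Context d (Omega : measurableType d).
Implicit Types F G : Omega -> Prop.

Lemma measurable_forall (F : nat -> Omega -> Prop) :
  (forall i, measurable [set w | F i w]) -> measurable [set w | forall i, F i w].
Proof.
move=> mF; rewrite (_ : [set w | _] = \bigcap_i [set w | F i w]).
  exact: bigcapT_measurable.
by apply/seteqP; split => w /= h; [move=> i _; exact: h|move=> i; exact: h].
Qed.

Lemma measurable_exists (F : nat -> Omega -> Prop) :
  (forall i, measurable [set w | F i w]) -> measurable [set w | exists i, F i w].
Proof.
move=> mF; rewrite (_ : [set w | _] = \bigcup_i [set w | F i w]).
  exact: bigcupT_measurable.
by apply/seteqP; split => w /= [i]; [move=> h; exists i|move=> _ h; exists i].
Qed.

Lemma measurable_exists_count (X : countType) (F : X -> Omega -> Prop) :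
  (forall x, measurable [set w | F x w]) -> measurable [set w | exists x, F x w].
Proof.
move=> mF.
rewrite (_ : [set w | _] = [set w | exists i, oapp (F ^~ w) False (@unpickle X i)]).
  apply: measurable_exists => i; case: (unpickle i) => [x|] /=; first exact: mF.
  rewrite (_ : [set _ | _] = set0)//.
apply/seteqP; split => w /=.
  by move=> [x Fx]; exists (pickle x); rewrite pickleK.
by move=> [i]; case: (unpickle i) => [x|//] /= Fx; exists x.
Qed.

Lemma measurable_and_set F G : measurable [set w | F w] -> measurable [set w | G w] ->
  measurable [set w | F w /\ G w].
Proof. by move=> mF mG; exact: (measurableI _ _ mF mG). Qed.

Lemma measurable_or_set F G : measurable [set w | F w] -> measurable [set w | G w] ->
  measurable [set w | F w \/ G w].
Proof. by move=> mF mG; exact: (measurableU _ _ mF mG). Qed.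

Lemma measurable_not_set F : measurable [set w | F w] -> measurable [set w | ~ F w].
Proof. by move=> mF; exact: (measurableC mF). Qed.

Lemma measurable_cst_set (p : Prop) : measurable [set w : Omega | p].
Proof.
have [h|h] := pselect p.
  by rewrite (_ : [set _ | _] = setT)//; apply/seteqP; split.
by rewrite (_ : [set _ | _] = set0)//; apply/seteqP; split.
Qed.

Lemma measurable_imply_set (p : Prop) F : (p -> measurable [set w | F w]) ->
  measurable [set w | p -> F w].
Proof.
move=> mF; have [h|h] := pselect p.
  rewrite (_ : [set w | p -> F w] = [set w | F w]); first exact: mF.
  by apply/seteqP; split => w /=; [exact|].
by rewrite (_ : [set _ | _] = setT)//; apply/seteqP; split=> // w _ /=.
Qed.

Context {R : realType}.

(** A Cauchy criterion with countable quantifiers only, so that the set of convergence is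
    measurable. *)
Lemma cvgn_cauchyP (u : nat -> R) : cvgn u <->
  forall k, exists N, forall i, `|u N - u (N + i)%N| <= k.+1%:R^-1.
Proof.
split=> [cu k|h].
  have e0 : 0 < (k.+1%:R : R)^-1 / 2 by rewrite divr_gt0// invr_gt0 ltr0n.
  have /cvgrPdist_le /(_ _ e0) [N _ hN] := cu.
  exists N => i; rewrite -(subrKA (limn u)) (le_trans (ler_normD _ _))//.
  rewrite [leRHS]splitr lerD// ?(distrC (u N)); first exact: (hN N (leqnn N)).
  by apply: (hN (N + i)%N); exact: leq_addr.
apply/cauchy_cvgP/cauchy_exP => _/posnumP[e].
have [N hN] := h (Num.truncn (e%:num)^-1).
exists (u N); exists N => // i /= Ni.
rewrite /ball /= -(subnKC Ni); apply: le_lt_trans (hN _) _.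
by rewrite invf_plt ?posrE ?ltr0n//; exact: truncnS_gt.
Qed.

Lemma measurable_fun_limn (h : nat -> Omega -> R) :
  (forall m, measurable_fun [set: Omega] (h m)) ->
  measurable_fun [set: Omega] (fun w => limn (h ^~ w)).
Proof.
move=> mh; pose D := [set w | cvgn (h ^~ w)].
have mD : measurable D.
  rewrite (_ : D = [set w | forall k, exists N, forall i, `|h N w - h (N + i)%N w| <=
    k.+1%:R^-1]).
    apply: measurable_forall => k; apply: measurable_exists => N; apply: measurable_forall => i.
    rewrite -[X in measurable X]setTI; apply: (@measurable_fun_le _ _ R _ _ (cst _)) => //.
    by apply: measurableT_comp => //; exact: measurable_funB.
  by apply/seteqP; split => w /cvgn_cauchyP.
rewrite -(setvU D) ; apply/measurable_funU => //; first exact: measurableC.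
split; last first.
  apply: (@measurable_fun_cvg _ _ R D h) => // m; exact: measurable_funTS.
(* Off the set of convergence [limn] returns the default value [point], hence is constant. *)
apply: (eq_measurable_fun (cst (point : R))) => // w.
rewrite inE => nDw; apply/esym; exact: dvgP.
Qed.

End MeasurableSets.

Section Measurability.
Context {R : realType} {X : countType} d (Omega : measurableType d).
Variables (P : nat -> Omega -> R) (T : nat -> Omega -> X).
Hypothesis mT : forall i x, measurable [set w | T i w = x].
Hypothesis mP : forall i, measurable_fun [set: Omega] (P i).

Lemma measurable_blk i j : measurable [set w | blk (T ^~ w) i = j].
Proof.
elim: i j => [|i ih] j /=; first exact: measurable_cst_set.
rewrite (_ : [set w | _] = [set w | exists x y k, [/\ T i w = x, T i.+1 w = y & blk (T ^~ w)
  i = k /\ (k + (y != x))%N = j]]).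
  apply: measurable_exists_count => x; apply: measurable_exists_count => y.
  apply: measurable_exists => k.
  rewrite (_ : [set w | _] = [set w | T i w = x /\ (T i.+1 w = y /\ (blk (T ^~ w) i = k /\ (k
    + (y != x))%N = j))]).
    apply: measurable_and_set => //; apply: measurable_and_set => //.
    apply: measurable_and_set => //; exact: measurable_cst_set.
  by apply/seteqP; split => w /=; [move=> [? ? ?]|move=> [? [? ?]]]; split.
apply/seteqP; split => w /=; last by move=> [x [y [k [<- <- [<- <-]]]]].
by move=> <-; exists (T i w), (T i.+1 w), (blk (T ^~ w) i).
Qed.

Lemma measurable_switch_state j x : measurable [set w | switch_state (T ^~ w) j = x].
Proof.
rewrite (_ : [set w | _] = [set w | exists i, T i w = x /\ (blk (T ^~ w) i = j \/
     ((exists l, blk (T ^~ w) i = l /\ (l < j)%N) /\ forall k, (i <= k)%N -> T k w = x))]).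
  apply: measurable_exists => i; apply: measurable_and_set => //.
  apply: measurable_or_set; first exact: measurable_blk.
  apply: measurable_and_set; last first.
    by apply: measurable_forall => k; apply: measurable_imply_set.
  apply: measurable_exists => l; apply: measurable_and_set; first exact: measurable_blk.
  exact: measurable_cst_set.
apply/seteqP; split => w /=.
  move=> /switch_stateP [i [Ti h]]; exists i; split=> //.
  by case: h => [->|[lt h]]; [left|right; split=> //; exists (blk (T ^~ w) i)].
move=> [i [Ti h]]; apply/switch_stateP; exists i; split=> //.
by case: h => [->|[[l [<- lt]] h]]; [left|right; split].
Qed.

Lemma measurable_clump j : measurable_fun [set: Omega] (fun w => clump (T ^~ w) (P ^~ w) j).
Proof.
rewrite (_ : (fun w => _) = fun w => limn ((fun m w => \sum_(0 <= i < m | blk (T ^~ w) i ==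
  j) P i w) ^~ w)); last first.
  by apply/funext => w; rewrite clumpE.
apply: measurable_fun_limn => m.
rewrite (_ : (fun w => _) = fun w => \sum_(0 <= i < m) (P i w * \1_[set w | blk (T ^~ w) i =
  j] w)).
  apply: measurable_sum => i; apply: measurable_funM => //.
  by apply: measurable_indic; exact: measurable_blk.
apply/funext => w; rewrite big_mkcond; apply: eq_bigr => i _.
rewrite indicE; case: eqP => h; first by rewrite mem_set// mulr1.
by rewrite memNset// mulr0.
Qed.

Lemma measurable_clumped_event n (zs : n.-tuple X) (A : set (n.-tuple R)) :
  measurable A ->
  measurable [set w | (forall i : 'I_n, switch_state (T ^~ w) i = tnth zs i) /\
                A (tup n (fun j => clump (T ^~ w) (P ^~ w) j))].
Proof.
move=> mA; apply: measurable_and_set.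
  rewrite (_ : [set w | _] = [set w | forall i, forall h : (i < n)%N, switch_state (T ^~ w) i
    = tnth zs (Ordinal h)]).
    apply: measurable_forall => i; have [h|h] := pselect (i < n)%N.
      rewrite (_ : [set w | _] = [set w | switch_state (T ^~ w) i = tnth zs (Ordinal h)]).
        exact: measurable_switch_state.
      by apply/seteqP; split => w /=; [exact|move=> -> h'; congr tnth; exact: val_inj].
    rewrite (_ : [set _ | _] = setT)//; apply/seteqP; split => // w _ /= h'.
    by case: (h h').
  apply/seteqP; split => w /= h; first by move=> i ilt; exact: (h (Ordinal ilt)).
  by move=> [i ilt]; exact: h.
have mg := @measurable_tup R _ Omega n (fun j w => clump (T ^~ w) (P ^~ w) j)
   (fun j _ => measurable_clump j).
by have := mg measurableT _ mA; rewrite setTI.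
Qed.

End Measurability.

(** Both sets have the same trace off the null set [N], and their parts inside [N] have measure
    0. *)
Lemma eq_measure_off_null {R : realType} d (Omega : measurableType d)
    (Pr : {measure set Omega -> \bar R}) (A B N : set Omega) :
  measurable A -> measurable B -> measurable N -> Pr N = 0%E ->
  (forall w, ~ N w -> (A w <-> B w)) -> Pr A = Pr B.
Proof.
move=> mA mB mN N0 AB.
have H C : measurable C -> Pr C = Pr (C `\` N).
  move=> mC; rewrite (measureDI Pr mC mN).
  by rewrite (@subset_measure0 _ _ _ Pr (C `&` N) N) ?adde0//; exact: measurableI.
rewrite (H A)// (H B)//; congr (Pr _); apply/seteqP; split => w [Cw nNw]; split=> //;
by apply/(AB w nNw).
Qed.

(** * The law of the clumped process *)

Section ChainProd.
Context {R : realType} {X : countType}.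
Implicit Types K : X -> X -> R.

Lemma chain_prod_rcons K y s z :
  chain_prod K y (rcons s z) = chain_prod K y s * K (last y s) z.
Proof.
elim: s y => [|x s ih] y /=; first by rewrite mul1r mulr1.
by rewrite ih mulrA.
Qed.

Lemma chain_prod_ge0 K y s : (forall x z, 0 <= K x z) -> 0 <= chain_prod K y s.
Proof. by move=> K0; elim: s y => [|x s ih] y //=; rewrite mulr_ge0. Qed.

Definition word (t : nat -> X) N := map t (iota 0 N).

Lemma wordS t N : word t N.+1 = rcons (word t N) (t N).
Proof. by rewrite /word -addn1 iotaD map_cat /= cats1 add0n. Qed.

Lemma last_word x t N : last x (word t N.+1) = t N.
Proof. by rewrite wordS last_rcons. Qed.

Lemma eq_word t t' N : (forall i, (i < N)%N -> t i = t' i) -> word t N = word t' N.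
Proof.
by move=> h; apply/eq_in_map => i; rewrite mem_iota add0n => /andP[_ /h].
Qed.

Lemma markov_wordS (mu : X -> R) K t N :
  markov_prob mu K (word t N.+2) = markov_prob mu K (word t N.+1) * K (t N) (t N.+1).
Proof.
have := last_word (t 0%N) t N; rewrite [word t N.+2]wordS /= chain_prod_rcons.
by rewrite mulrA => ->.
Qed.

End ChainProd.

(** * Laws of events read off a word and finitely many masses *)

Section Main.
Context {R : realType} {d} {Omega : measurableType d} (Pr : probability Omega R)
  {X : countType}.
Variables (theta : R) (mu : X -> R) (Q : X -> X -> R)
  (P : nat -> Omega -> R) (T : nat -> Omega -> X).
Hypothesis th0 : 0 < theta.
Hypothesis mu0 : forall x, 0 <= mu x.
Hypothesis Q0 : forall x y, 0 <= Q x y.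
Hypothesis Q1 : forall x, (\esum_(y in [set: X]) (Q x y)%:E = 1)%E.
Hypothesis mT : forall i x, measurable [set w | T i w = x].
Hypothesis mP : forall i, measurable_fun [set: Omega] (P i).
Hypothesis law : GEM_indep_markov Pr theta P T mu Q.

Lemma Q_le1 x : Q x x <= 1.
Proof.
rewrite -lee_fin -(Q1 x); apply: esum_ge; exists [set x]; last by rewrite fsbig_set1.
by split.
Qed.

Definition word_event (t : nat -> X) N := [set w | forall i, (i < N)%N -> T i w = t i].
Definition word_prob t N := markov_prob mu Q (word t N).

Lemma word_prob_ge0 t N : 0 <= word_prob t N.
Proof.
rewrite /word_prob; case: (word t N) => [|x s] /=; first exact: ler01.
by rewrite mulr_ge0// chain_prod_ge0.
Qed.

Lemma measurable_word_event t N : measurable (word_event t N).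
Proof.
apply: measurable_forall => i; exact: measurable_imply_set.
Qed.

Lemma word_law t N (B : set (N.-tuple R)) : measurable B ->
  Pr (word_event t N `&` [set w | B (tup N (P ^~ w))]) =
  ((word_prob t N)%:E * beta1_prod (nseq N theta) [set xs | B (tup N (stick xs))])%E.
Proof.
move=> mB; have := law [tuple t i | i < N] mB.
have -> : [set w | (forall i : 'I_N, T i w = tnth [tuple t i | i < N] i) /\
    B (tup N (P ^~ w))] =
   word_event t N `&` [set w | B (tup N (P ^~ w))].
  apply/seteqP; split => w /= [h Bw]; split=> //.
    by move=> i iN; have := h (Ordinal iN); rewrite tnth_mktuple.
  by move=> i; rewrite tnth_mktuple; apply: h.
move=> ->; congr (_%:E * beta1_prod _ _)%E.
  by rewrite /word_prob /word -val_enum_ord -map_comp.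
rewrite -[in RHS](size_tuple [tuple t i | i < N]).
by elim: (tval _) => //= a l ->.
Qed.

Lemma nnegs_th N : nnegs (nseq N theta).
Proof. exact/nnegs_nseq/ltW. Qed.

(** The functionals [g j] of the mass sequence, j < n, will be the clump masses on a given word. *)
Definition stick_event n (A : set (n.-tuple R)) (g : nat -> (nat -> R) -> R) (p : nat -> R) :
  Prop :=
  A (tup n (g ^~ p)).

Definition depends_below N (g : nat -> (nat -> R) -> R) := forall j p p',
  (forall i, (i < N)%N -> p i = p' i) -> g j p = g j p'.

Lemma depends_belowW N M g : (N <= M)%N -> depends_below N g -> depends_below M g.
Proof.
by move=> NM lg j p p' pp'; apply: lg => i iN; apply: pp'; exact: leq_trans NM.
Qed.

Definition cwise_measurable (g : nat -> (nat -> R) -> R) :=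
  forall M j, measurable_fun [set: M.-tuple R] (fun s : M.-tuple R => g j (nth 0 s)).

Lemma stick_event_tup n (A : set (n.-tuple R)) g N p : depends_below N g ->
  stick_event A g (nth 0 (tup N p)) <-> stick_event A g p.
Proof.
move=> lg; rewrite /stick_event; have -> : g ^~ (nth 0 (tup N p)) = g ^~ p; last by [].
apply/funext => j; apply: lg => i iN.
by rewrite -(tnth_nth 0 _ (Ordinal iN)) tnth_mktuple.
Qed.

(** An event that reads only the first [N] masses is an event about their [N]-tuple, to which
    [word_law] applies. *)
Lemma word_stick_law n (A : set (n.-tuple R)) g t N : measurable A -> cwise_measurable g ->
  depends_below N g ->
  Pr (word_event t N `&` [set w | stick_event A g (P ^~ w)]) =
  ((word_prob t N)%:E * beta1_prod (nseq N theta) [set xs | stick_event A g (stick xs)])%E.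
Proof.
move=> mA mg lg.
have mB : measurable [set s : N.-tuple R | stick_event A g (nth 0 s)].
  have := @measurable_tup R _ _ n (fun j (s : N.-tuple R) => g j (nth 0 s)) (fun j _ => mg N j).
  by move=> /(_ measurableT _ mA); rewrite setTI.
have := word_law t mB; congr (Pr _ = _).
  apply/seteqP; split => w /= [pw h]; split=> //.
    exact: (stick_event_tup A (P ^~ w) lg).1.
  exact: (stick_event_tup A (P ^~ w) lg).2.
congr (_ * beta1_prod _ _)%E.
by apply/seteqP; split => s /= /(stick_event_tup A (stick s) lg).
Qed.

Lemma indicE_iff (U V : Type) (C : set U) (D : set V) x y : (C x <-> D y) ->
  (\1_C x : R) = \1_D y.
Proof.
move=> h; rewrite !indicE; have [Dy|nDy] := pselect (D y).
  by rewrite !mem_set//; exact/h.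
by rewrite !memNset// => /h.
Qed.

Lemma eq_beta1_prod al (C D : set (seq R)) :
  (forall s, size s = size al -> C s <-> D s) -> beta1_prod al C = beta1_prod al D.
Proof.
move=> CD; rewrite !beta1_prodE; apply: eq_beta1_iter => s sz _.
by congr (_%:E); apply: indicE_iff; exact: CD.
Qed.

Lemma beta1_prod_last al (a : R) (C D : set (seq R)) : 0 <= a ->
  (forall s x, size s = size al -> C (rcons s x) <-> D s) ->
  beta1_prod (rcons al a) C = beta1_prod al D.
Proof.
move=> a0 CD; rewrite !beta1_prodE -cats1 beta1_iter_cat.
apply: eq_beta1_iter => s sz _ /=.
rewrite -[RHS](@beta1_int_cst R a)//; apply: eq_beta1_int => x _.
by congr (_%:E); apply: indicE_iff; rewrite cats1; exact: CD.
Qed.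

Lemma beta1_prod_le1 al n (A : set (n.-tuple R)) b : nnegs al -> measurable A ->
  (beta1_prod al [set u | A (tup n (clump_sum b u))] <= 1)%E.
Proof.
move=> al0 mA; rewrite beta1_prodE -(beta1_iter_cst al0 ler01).
apply: le_beta1_iter => //.
- apply: seq_measurable_indic => // j _; exact: measurable_clump_sum.
- exact: measurable_cst.
- by move=> s _ _; rewrite lee_fin indicE lern1 leq_b1.
Qed.

Lemma beta1_prod_ge0 al (D : set (seq R)) : nnegs al -> (0 <= beta1_prod al D)%E.
Proof. by move=> al0; rewrite beta1_prodE; exact: beta1_iter_ge0. Qed.

Lemma rcons_nseq k (a : R) : rcons (nseq k a) a = nseq k.+1 a.
Proof. by elim: k => //= k ->. Qed.

(** The word has one letter more than the masses that are read; the fraction of that letter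
    integrates to 1. *)
Lemma word_stick_lawS n (A : set (n.-tuple R)) g t N : measurable A -> cwise_measurable g ->
  depends_below N g ->
  Pr (word_event t N.+1 `&` [set w | stick_event A g (P ^~ w)]) =
  ((word_prob t N.+1)%:E * beta1_prod (nseq N theta) [set xs | stick_event A g (stick xs)])%E.
Proof.
move=> mA mg lg; rewrite word_stick_law//; last exact: depends_belowW (leqnSn _) lg.
congr (_ * _)%E; rewrite -rcons_nseq; apply: beta1_prod_last; first exact: ltW.
move=> s x; rewrite size_nseq => sz; rewrite /= /stick_event.
have -> : g ^~ (stick (rcons s x)) = g ^~ (stick s); last by [].
by apply/funext => j; apply: lg => i iN; rewrite -cats1 stick_cat// sz.
Qed.

Lemma word_event_prob t N : Pr (word_event t N) = (word_prob t N)%:E.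
Proof.
have := @word_law t N setT measurableT.
rewrite [X in _ `&` X](_ : _ = setT)// setIT => ->.
rewrite beta1_prodE (_ : (fun s => _) = fun=> 1%:E); last first.
  by apply/funext => s; rewrite indicE mem_set.
by rewrite beta1_iter_cst// ?mule1//; exact: nnegs_th.
Qed.


Lemma beta1_prod_eq0 al (D : set (seq R)) : nnegs al ->
  (forall s, size s = size al -> all unit_itv s -> ~ D s) -> beta1_prod al D = 0%E.
Proof.
move=> al0 nD; rewrite beta1_prodE -[RHS](beta1_iter_cst al0 (lexx 0)).
by apply: eq_beta1_iter => s sz s01; rewrite indicE memNset//; exact: nD.
Qed.

Lemma beta1_iter_nseq0 k F : beta1_iter (nseq k (0 : R)) F = F (nseq k 1).
Proof. by elim: k F => [//|k ih] F /=; rewrite /beta1_int eqxx ih. Qed.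

Lemma eq_tup n (f g : nat -> R) : (forall j, (j < n)%N -> f j = g j) -> tup n f = tup n g.
Proof. by move=> fg; apply: eq_from_tnth => i; rewrite !tnth_mktuple fg. Qed.

Lemma word_stick_real_law t M (h : (nat -> R) -> R) (C : set R) : measurable C ->
  (forall M', measurable_fun [set: M'.-tuple R] (fun s : M'.-tuple R => h (nth 0 s))) ->
  (forall p p', (forall i, (i < M)%N -> p i = p' i) -> h p = h p') ->
  Pr (word_event t M `&` [set w | C (h (P ^~ w))]) =
  ((word_prob t M)%:E * beta1_prod (nseq M theta) [set xs | C (h (stick xs))])%E.
Proof.
move=> mC mh lh.
have mA : measurable [set s : 1.-tuple R | C (tnth s ord0)].
  by have := @measurable_tnth _ R 1 ord0 measurableT _ mC; rewrite setTI.
have e p : stick_event [set s : 1.-tuple R | C (tnth s ord0)] (fun=> h) p = C (h p).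
  by rewrite /stick_event /= tnth_mktuple.
have := @word_stick_law 1 _ (fun=> h) t M mA (fun M' _ => mh M') (fun _ p p' => lh p p').
by under eq_set do rewrite e; under [X in beta1_prod _ X]eq_set do rewrite e.
Qed.

Lemma measurable_psum b N M :
  measurable_fun [set: M.-tuple R] (fun s : M.-tuple R => \sum_(0 <= i < N | b i) (tval s)`_i).
Proof.
under eq_fun do rewrite big_mkcond; apply: measurable_sum => i.
by case: (b i); [exact: measurable_nth|exact: measurable_cst].
Qed.

Lemma eq_psum (b : pred nat) N (p p' : nat -> R) : (forall i, (i < N)%N -> p i = p' i) ->
  \sum_(0 <= i < N | b i) p i = \sum_(0 <= i < N | b i) p' i.
Proof.
by move=> pp'; rewrite big_nat_cond [RHS]big_nat_cond; apply: eq_bigr => i /andP[/andP[_ /pp']].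
Qed.

Lemma word_prob_le1 t N : word_prob t N <= 1.
Proof. by rewrite -lee_fin -word_event_prob; exact: probability_le1 (measurable_word_event t
  N). Qed.

Lemma null_exists (F : nat -> Omega -> Prop) :
  (forall i, measurable [set w | F i w]) -> (forall i, Pr [set w | F i w] = 0%E) ->
  Pr [set w | exists i, F i w] = 0%E.
Proof.
move=> mF F0; apply: (negligibleP Pr (measurable_exists mF)).1.
rewrite (_ : [set w | _] = \bigcup_i [set w | F i w]).
  by apply: negligible_bigcup => i; apply/(negligibleP Pr (mF i)); exact: F0.
by apply/seteqP; split => w /= [i]; [move=> h; exists i|move=> _ h; exists i].
Qed.

(** * Almost sure properties of the masses along a path *)

Section Tail.
Variable t : nat -> X.

Let measurable_real (h : (nat -> R) -> R) (C : set R) : measurable C ->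
  measurable_fun [set: Omega] (fun w => h (P ^~ w)) -> measurable [set w | C (h (P ^~ w))].
Proof. by move=> mC mh; have := mh measurableT _ mC; rewrite setTI. Qed.

Let measurable_PS M : measurable_fun [set: Omega] (fun w => \sum_(0 <= i < M) P i w).
Proof. by apply: measurable_sum => i. Qed.

Lemma null_neg : Pr [set w | exists i, word_event t i.+1 w /\ P i w < 0] = 0%E.
Proof.
apply: null_exists => i.
  apply: measurable_and_set; first exact: measurable_word_event.
  rewrite (_ : [set _ | _] = [set w | `]-oo, 0[%classic (P i w)]).
    by apply: (@measurable_real (fun p => p i)); [exact: measurable_itv|exact: mP].
  by apply/seteqP; split => w /=; rewrite in_itv.
have := @word_stick_real_law t i.+1 (fun p => p i) _ (measurable_itv `]-oo, 0[)
  (fun M => @measurable_nth R M i) (fun p p' pp' => pp' i (leqnn _)).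
rewrite beta1_prod_eq0; last 2 first.
- exact: nnegs_th.
- move=> s sz s01 /=; rewrite in_itv /= => lt0.
  by have := stick_ge0 i s01; rewrite leNgt lt0.
rewrite mule0 => <-.
by congr (Pr _); apply/seteqP; split => w /= [? h]; split=> //; move: h; rewrite in_itv.
Qed.

(** The first [M] sticks add up to 1 minus the residual, and the residual is nonnegative. *)
Lemma null_sum_gt1 :
  Pr [set w | exists M, word_event t M w /\ 1 < \sum_(0 <= i < M) P i w] = 0%E.
Proof.
apply: null_exists => M.
  apply: measurable_and_set; first exact: measurable_word_event.
  rewrite (_ : [set _ | _] = [set w | `]1, +oo[%classic (\sum_(0 <= i < M) P i w)]).
    apply: (@measurable_real (fun p => \sum_(0 <= i < M) p i)); last exact: measurable_PS.
    exact: measurable_itv.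
  by apply/seteqP; split => w /=; rewrite in_itv /= andbT.
have := @word_stick_real_law t M (fun p => \sum_(0 <= i < M) p i) _ (measurable_itv `]1, +oo[)
  (fun M' => @measurable_psum xpredT M M') (fun p p' => @eq_psum xpredT M p p').
rewrite beta1_prod_eq0; last 2 first.
- exact: nnegs_th.
- move=> s; rewrite size_nseq => sz s01 /=; rewrite in_itv /= andbT -sz sum_stick.
  by have /andP[r0 _] := residual_unit s01; rewrite ltrDl oppr_gt0 ltNge r0.
rewrite mule0 => <-.
by congr (Pr _); apply/seteqP; split => w /= [? h]; split=> //; move: h;
  rewrite in_itv /= andbT.
Qed.

(** The mean residual after [M] fractions is (theta / (theta + 1))^M, so by Markov's inequality the
    partial sum is below 1 - 1/(k + 1) with probability at most k + 1 times this, which tends to 0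
    as [M] grows. *)
Lemma null_sum_lt1 : Pr [set w | exists k, forall M,
   word_event t M w /\ \sum_(0 <= i < M) P i w < 1 - k.+1%:R^-1] = 0%E.
Proof.
have mF k M : measurable [set w | word_event t M w /\ \sum_(0 <= i < M) P i w < 1 - k.+1%:R^-1].
  apply: measurable_and_set; first exact: measurable_word_event.
  rewrite (_ : [set _ | _] = [set w | `]-oo, 1 - k.+1%:R^-1[%classic (\sum_(0 <= i < M) P i
    w)]).
    apply: (@measurable_real (fun p => \sum_(0 <= i < M) p i)); last exact: measurable_PS.
    exact: measurable_itv.
  by apply/seteqP; split => w /=; rewrite in_itv.
apply: null_exists => k; first by apply: measurable_forall => M; exact: mF.
pose r : R := theta / (theta + 1).
have th10 : 0 < theta + 1 by exact: addr_gt0.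
have r0 : 0 <= r by rewrite divr_ge0// ltW.
have r1 : `|r| < 1 by rewrite ger0_norm// ltr_pdivrMr// mul1r ltrDl.
have bound M : (Pr [set w | word_event t M w /\ (\sum_(0 <= i < M) P i w < 1 - k.+1%:R^-1)%R] <=
    (geometric k.+1%:R r M)%:E)%E.
  have H := @word_stick_real_law t M (fun p => \sum_(0 <= i < M) p i) _
    (measurable_itv `]-oo, 1 - k.+1%:R^-1[)
    (fun M' => @measurable_psum xpredT M M') (fun p p' => @eq_psum xpredT M p p').
  have -> : [set w | word_event t M w /\ \sum_(0 <= i < M) P i w < 1 - k.+1%:R^-1] =
     word_event t M `&` [set w | `]-oo, 1 - k.+1%:R^-1[%classic (\sum_(0 <= i < M) P i w)].
    by apply/seteqP; split => w /= [? h]; split=> //; move: h; rewrite in_itv.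
  rewrite H; apply: (@le_trans _ _ (beta1_prod (nseq M theta)
     [set xs | `]-oo, (1 - k.+1%:R^-1)%R[%classic (\sum_(0 <= i < M) stick xs i)%R])).
    rewrite -[leRHS]mul1e; apply: lee_wpmul2r.
      by apply: beta1_prod_ge0; exact: nnegs_th.
    by rewrite lee_fin word_prob_le1.
  rewrite beta1_prodE /geometric /= EFinM -(beta1_iter_residual M th0).
  rewrite -(@beta1_iterZ R _ k.+1%:R (fun s => (k.+1%:R * `|residual s|)%:E)); last 5 first.
  - exact: nnegs_th.
  - exact: ler0n.
  - by rewrite size_nseq; exact: seq_measurable_normr_residual.
  - by move=> s; rewrite lee_fin.
  - by move=> s _ _; rewrite EFinM.
  apply: le_beta1_iter.
  - exact: nnegs_th.
  - rewrite size_nseq; apply/measurable_EFinP.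
    have mh := @measurable_sum _ _ R setT _ (index_iota 0 M) (fun i (s : M.-tuple R) => stick
      s i)
      (fun i => @measurable_stick R M i).
    have := measurableT_comp (@measurable_indic _ R R setT _ (measurable_itv `]-oo, 1 -
      k.+1%:R^-1[)) mh.
    exact.
  - rewrite size_nseq; apply/measurable_EFinP; apply: measurable_funM => //.
    by apply: measurableT_comp => //; exact: measurable_residual.
  - by move=> s; rewrite lee_fin.
  - by move=> s; rewrite lee_fin mulr_ge0.
  (* Markov's inequality pointwise: on the event the residual exceeds 1/(k + 1). *)
  move=> s; rewrite size_nseq => sz s01; rewrite lee_fin indicE.
  have [|_] := boolP (_ \in _); last by rewrite mulr_ge0.
  rewrite inE /= in_itv /= -{1}sz sum_stick ltrD2l ltrN2 => lt.
  rewrite -ler_pdivrMl ?ltr0n// mulr1 (le_trans (ltW lt))//; exact: ler_norm.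
apply/eqP; rewrite eq_le measure_ge0 andbT; apply/lee_addgt0Pr => e e0; rewrite add0e.
have /cvgrPdist_le /(_ _ e0) [M _ hM] := cvg_geometric (k.+1%:R : R) r1.
apply: (@le_trans _ _ (geometric k.+1%:R r M)%:E).
  apply: le_trans (bound M); apply: le_measure; rewrite ?inE//.
    by apply: measurable_forall => M'; exact: mF.
  by move=> w /= h; exact: h.
rewrite lee_fin; have := hM M (leqnn M); rewrite sub0r normrN => /(le_trans _) -> //.
exact: ler_norm.
Qed.

End Tail.

(** * Comparison of the two laws along words *)

Section Claim.
Variables (n : nat) (zf : nat -> X) (A : set (n.-tuple R)).
Hypothesis mA : measurable A.

Let K := gen_kernel (theta_QmI theta Q).
Let par (y : X) : R := - theta_QmI theta Q y y.
Let E := [set w | (forall i : 'I_n, switch_state (T ^~ w) i = zf i) /\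
                A (tup n (fun j => clump (T ^~ w) (P ^~ w) j))].
Let B b : set (seq R) := [set u | A (tup n (clump_sum b u))].

Let mE : measurable E.
Proof.
have := measurable_clumped_event mT mP [tuple zf i | i < n] mA.
rewrite (_ : [set w | _] = E)//; apply/seteqP; split => w /= [h Aw]; split=> // i.
  by rewrite h tnth_mktuple.
by rewrite h tnth_mktuple.
Qed.

Let parE y : par y = theta * (1 - Q y y).
Proof. by rewrite /par /theta_QmI eqxx /= mulr1n; ring. Qed.

Let par_ge0 y : 0 <= par y.
Proof. by rewrite parE; apply: mulr_ge0; [exact: ltW|rewrite subr_ge0; exact: Q_le1]. Qed.

Let K_ge0 x y : 0 <= K x y.
Proof.
rewrite /K /gen_kernel; case: ifPn => [xy|_]; case: ifP => // _.
apply: divr_ge0; last exact: (par_ge0 x).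
rewrite /theta_QmI (negbTE xy) subr0; apply: mulr_ge0 => //; exact: ltW.
Qed.

(** The chain leaves [x] with probability 1 - Q x x and then picks [y] by [K]; the factor [theta]
    cancels. *)
Let K_switch x y : x != y -> Q x x != 1 -> K x y * (1 - Q x x) = Q x y.
Proof.
move=> xy qx; have q1 : 1 - Q x x != 0 by rewrite subr_eq0 eq_sym.
have thn0 : theta != 0 by rewrite gt_eqF.
have -> : K x y = theta * Q x y / (theta * (1 - Q x x)).
  rewrite /K /gen_kernel xy -/(par x) parE ifT; last first.
    by rewrite -oppr_eq0 -/(par x) parE mulf_neq0.
  by congr (_ * _ / _); rewrite (negbTE xy) subr0.
by field; rewrite thn0 q1.
Qed.

Let K_same x : Q x x != 1 -> K x x = 0.
Proof.
move=> qx; rewrite /K /gen_kernel eqxx /= ifF//; apply/negbTE.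
rewrite -oppr_eq0 -/(par x) parE; apply: mulf_neq0; first by rewrite gt_eqF.
by rewrite subr_eq0 eq_sym.
Qed.

Let nnegs_par l : nnegs (map par l).
Proof. by rewrite /nnegs all_map; apply/allP => x _ /=. Qed.

Let nnegs_params N l : nnegs (nseq N theta ++ map par l).
Proof. by rewrite /nnegs all_cat; apply/andP; split; [exact: nnegs_th|exact: nnegs_par]. Qed.

(* The first [N] fractions are i.i.d. Beta(1,theta) and follow the blocks of the
   word [t]; each later fraction is a whole clump. *)
Definition clump_index (t : nat -> X) N i := (blk t i + (i - N))%N.

(** The word of the letters 0 to [N] runs through the states [zf] block by block and ends in block
    [m]. Freezing [t] after [N] makes longer words of the same path repeat the last state. *)
Definition compat (t : nat -> X) N m :=
  [/\ forall i, (i <= N)%N -> t i = zf (blk t i), blk t N = m &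
      forall i, (N <= i)%N -> t i = t N].

Let Lv t N := Pr (word_event t N.+1 `&` E).

(** The predicted value R(t) for a word of N + 1 letters: [N] fractions for the letters before the
    last one, then one fraction for what block [m] takes from the last letter on, and one for each
    of the [k] later blocks. *)
Let Rv t N m k := ((word_prob t N.+1 * chain_prod K (zf m) (map zf (iota m.+1 k)))%:E *
   beta1_prod (nseq N theta ++ map par (map zf (iota m k.+1))) (B (clump_index t N)))%E.

Let compat_zf t N m : compat t N m -> t N = zf m.
Proof. by move=> [h e _]; rewrite h// e. Qed.

Let compatS t N m : compat t N m -> compat t N.+1 m.
Proof.
move=> [h e c]; have e1 : blk t N.+1 = m by rewrite -e; apply: blk_const.
split=> // [i|i Ni]; last by rewrite (c _ (ltnW Ni)) (c N.+1).
rewrite leq_eqVlt => /orP[/eqP ->|]; last exact: h.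
by rewrite e1 (c N.+1)// -(compat_zf (And3 h e c)).
Qed.

Let word_prob_const t N m : compat t N m -> word_prob t N.+2 = word_prob t N.+1 * Q (zf m)
  (zf m).
Proof.
move=> cp; have [h e c] := cp.
by rewrite /word_prob markov_wordS (c N.+1)// (compat_zf cp).
Qed.

(** The mixture equation in the coordinate of the current block: with weight 1 - q the last letter
    closes the block, with weight q the last state is repeated once more, and this factor q joins
    the word probability. *)
Let Rv_step t N m k : compat t N m -> Q (zf m) (zf m) < 1 ->
  Rv t N m k =
  ((word_prob t N.+1 * (chain_prod K (zf m) (map zf (iota m.+1 k)) * (1 - Q (zf m) (zf
    m))))%:E *
     beta1_prod (nseq N.+1 theta ++ map par (map zf (iota m.+1 k))) (B (clump_index t N))
   + Rv t N.+1 m k)%E.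
Proof.
move=> cp q1; have [h e c] := cp.
set q := Q (zf m) (zf m) in q1 *.
have q01 : 0 <= q < 1 by rewrite Q0.
rewrite /Rv (word_prob_const cp) -/q !beta1_prodE /= parE -/q.
have thl bl : nseq N theta ++ theta :: bl = theta :: nseq N theta ++ bl.
  by rewrite -cat_rcons rcons_nseq.
set bl := map par _.
have H := @beta1_iter_geom R (nseq N theta) bl theta q
  (fun s => (\1_(B (clump_index t N)) s)%:E) (fun s => (\1_(B (clump_index t N.+1)) s)%:E)
  (nnegs_th _) (nnegs_par _) th0 q01.
rewrite H; last 5 first.
- by move=> s; rewrite lee_fin.
- by move=> s; rewrite lee_fin.
- by apply: seq_measurable_indic => // j _; exact: measurable_clump_sum.
- by apply: seq_measurable_indic => // j _; exact: measurable_clump_sum.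
(* Under [clump_index t N.+1] the indices N and N + 1 both carry the label [m]; merging their
   fractions gives the labelling [clump_index t N]. *)
- move=> s x y u; rewrite size_nseq => sz; congr (_%:E); apply: indicE_iff.
  rewrite /B /=; have -> : (clump_sum (clump_index t N.+1) (s ++ [:: x, y & u])) =
            (clump_sum (clump_index t N) (s ++ (x + (1 - x) * y) :: u)); last by [].
  apply/funext => j; apply: clump_sum_merge; rewrite ?sz /clump_index.
  + by rewrite (blk_const c (leqnSn N)); lia.
  + by move=> i iN; lia.
  + by move=> i Ni; rewrite !(blk_const c)//; lia.
rewrite !thl ge0_muleDr; last 2 first.
- apply: mule_ge0; first by rewrite lee_fin subr_ge0 ltW.
  apply: (@beta1_iter_ge0 _ (theta :: nseq N theta ++ bl)).
    by apply/andP; split; [exact: ltW|exact: nnegs_params].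
  by move=> s; rewrite lee_fin.
- apply: mule_ge0; first by rewrite lee_fin; case/andP: q01.
  apply: (@beta1_iter_ge0 _ (theta :: nseq N theta ++ theta * (1 - q) :: bl)).
    apply/andP; split; [exact: ltW|].
    by have := nnegs_params N (zf m :: map zf (iota m.+1 k)); rewrite /= parE -/q.
  by move=> s; rewrite lee_fin.
rewrite !muleA -!EFinM; congr (_%:E * _ + _%:E * _)%E; first by rewrite mulrA.
by rewrite mulrAC.
Qed.

Let fin_Lv t N : Lv t N \is a fin_num.
Proof.
apply: fin_num_measure; apply: measurableI => //; exact: measurable_word_event.
Qed.

Let Lv_le t N : (Lv t N <= (word_prob t N.+1)%:E)%E.
Proof.
rewrite -word_event_prob; apply: le_measure; last exact: subIsetl.
  by rewrite inE; apply: measurableI => //; exact: measurable_word_event.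
by rewrite inE; exact: measurable_word_event.
Qed.

Let Rv_ge0 t N m k : (0 <= Rv t N m k)%E.
Proof.
apply: mule_ge0; last by apply: beta1_prod_ge0; exact: nnegs_params.
by rewrite lee_fin; apply: mulr_ge0; [exact: word_prob_ge0|exact: chain_prod_ge0].
Qed.

Let Rv_le t N m k :
  (Rv t N m k <= (word_prob t N.+1 * chain_prod K (zf m) (map zf (iota m.+1 k)))%:E)%E.
Proof.
rewrite -[leRHS]mule1; apply: lee_pmul => //.
- by rewrite lee_fin; apply: mulr_ge0; [exact: word_prob_ge0|exact: chain_prod_ge0].
- by apply: beta1_prod_ge0; exact: nnegs_params.
- by apply: beta1_prod_le1 => //; exact: nnegs_params.
Qed.

Let fin_Rv t N m k : Rv t N m k \is a fin_num.
Proof.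
rewrite ge0_fin_numE//; apply: le_lt_trans (Rv_le _ _ _ _) _; exact: ltry.
Qed.

(* The defect [L - R] does not change along the word [t], and both terms are
   bounded by the geometrically small probability of the word. *)
Let defect_eq0 t N m k : compat t N m -> Q (zf m) (zf m) < 1 ->
  (forall N', compat t N' m -> exists2 x, x \is a fin_num &
     Lv t N' = (x + Lv t N'.+1)%E /\ Rv t N' m k = (x + Rv t N'.+1 m k)%E) ->
  Lv t N = Rv t N m k.
Proof.
move=> cp q1 step; set q := Q (zf m) (zf m) in q1.
pose C := chain_prod K (zf m) (map zf (iota m.+1 k)).
pose D := fine (Lv t N) - fine (Rv t N m k).
have C0 : 0 <= C by exact: chain_prod_ge0.
have cpi i : compat t (N + i) m.
  by elim: i => [|i ih]; rewrite ?addn0// addnS; exact: compatS.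
have mwi i : word_prob t (N + i).+1 = word_prob t N.+1 * q ^+ i.
  elim: i => [|i ih]; first by rewrite addn0 expr0 mulr1.
  by rewrite addnS (word_prob_const (cpi i)) ih exprSr mulrA.
have De i : fine (Lv t (N + i)) - fine (Rv t (N + i) m k) = D.
  elim: i => [|i ih]; first by rewrite addn0.
  rewrite addnS -ih; have [x xf [-> ->]] := step _ (cpi i).
  by rewrite !fineD//; ring.
have Db i : `|D| <= geometric (word_prob t N.+1 * (1 + C)) q i.
  rewrite -(De i) (le_trans (ler_normB _ _))// ger0_norm ?fine_ge0 ?measure_ge0//.
  rewrite ger0_norm ?fine_ge0 ?Rv_ge0// /geometric /= mulrAC mulrDr mulr1 -mwi.
  by apply: lerD; rewrite -lee_fin fineK.
have [D0|Dn0] := eqVneq D 0.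
  rewrite -(fineK (fin_Lv t N)) -(fineK (fin_Rv t N m k)); congr (_%:E).
  by apply/eqP; rewrite -subr_eq0; apply/eqP.
have aq : `|q| < 1 by rewrite ger0_norm ?Q0.
have Dp : 0 < `|D| by rewrite normr_gt0.
have /cvgrPdist_lt /(_ _ Dp) [i _ hi] := cvg_geometric (word_prob t N.+1 * (1 + C)) aq.
have := hi i (leqnn i); rewrite sub0r normrN => /(le_lt_trans (ler_norm _)).
by rewrite ltNge Db.
Qed.

(** * Leaving the current block *)

Let blk_pre t N w i : word_event t N.+1 w -> (i <= N)%N -> blk (T ^~ w) i = blk t i.
Proof. by move=> pw; apply: eq_blk => l lN; exact: pw. Qed.

Let blk_next t N m w : compat t N m -> word_event t N.+1 w -> T N.+1 w != t N ->
  blk (T ^~ w) N.+1 = m.+1.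
Proof.
move=> [_ e _] pw ne; rewrite blkS (blk_pre pw (leqnn N)) e (pw N (leqnn _)) ne.
by rewrite addn1.
Qed.

Let next_state t N m w : compat t N m -> (m.+1 < n)%N -> word_event t N.+1 w -> E w ->
  T N.+1 w != t N -> T N.+1 w = zf m.+1.
Proof.
move=> cp mn pw [Ew _] ne.
have <- : switch_state (T ^~ w) m.+1 = zf m.+1 := Ew (Ordinal mn).
by rewrite -(blk_next cp pw ne) switch_state_blk.
Qed.

Let preS t N w : word_event t N.+1 w -> T N.+1 w = t N.+1 -> word_event t N.+2 w.
Proof. by move=> pw e i; rewrite ltnS leq_eqVlt => /orP[/eqP ->|/pw]. Qed.

Let pre_le t N M w : (M <= N)%N -> word_event t N w -> word_event t M w.
Proof. by move=> MN pw i iM; apply: pw; exact: leq_trans MN. Qed.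

(** The clump masses when the current block closes with letter [N], which is included in the
    range. *)
Let finish_sums (t : nat -> X) N (j : nat) (p : nat -> R) : R := \sum_(0 <= i < N.+1 | blk t
  i == j) p i.

(** Once [T] leaves block m = n - 1, all [n] clumps are complete: later letters have labels at least
    [n], and the states are already those of the word. *)
Let finish_event t N m w : compat t N m -> m.+1 = n -> word_event t N.+1 w ->
  T N.+1 w != t N -> E w <-> stick_event A (finish_sums t N) (P ^~ w).
Proof.
move=> cp mn pw ne; have [h e c] := cp; have bN := blk_next cp pw ne.
have clE j : (j < n)%N -> clump (T ^~ w) (P ^~ w) j = finish_sums t N j (P ^~ w).
  move=> jn; rewrite clumpE; apply/cvg_lim => //; apply: cvg_near_cst; near=> M.
  have NM : (N.+1 <= M)%N by near: M; exact: nbhs_infty_ge.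
  rewrite (big_cat_nat (leq0n _) NM) /= [X in _ + X](_ : _ = 0) ?addr0; last first.
    rewrite big_nat_cond big1// => i /andP[/andP[Ni _] /eqP ij].
    have := leq_blk (T ^~ w) Ni; rewrite bN ij => mj.
    by move: jn; rewrite -mn ltnNge mj.
  rewrite /finish_sums big_nat_cond [RHS]big_nat_cond; apply: eq_bigl => i.
  by case iN : (i < N.+1)%N; rewrite ?andbF//= (blk_pre pw).
have ssE j : (j < n)%N -> switch_state (T ^~ w) j = zf j.
  move=> jn; have [|i iN ij] := @blk_ivt _ (T ^~ w) N j.
    by rewrite (blk_pre pw)// e -ltnS mn.
  by rewrite -ij switch_state_blk (pw i)// h// (blk_pre pw).
have -> : stick_event A (finish_sums t N) (P ^~ w) = A (tup n (fun j => clump (T ^~ w) (P ^~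
  w) j)).
  by rewrite /stick_event; congr A; apply: eq_tup => j jn; rewrite clE.
by split=> [[]//|Aw]; split=> // i; exact: ssE.
Unshelve. all: by end_near. Qed.

Let cwise_finish_sums t N : cwise_measurable (finish_sums t N).
Proof. by move=> M j; exact: measurable_psum. Qed.

Let finish_sums_depends_below t N : depends_below N.+1 (finish_sums t N).
Proof. by move=> j p p' pp'; exact: eq_psum. Qed.

Let measurable_stick_event g : cwise_measurable g -> (exists N, depends_below N g) ->
  measurable [set w | stick_event A g (P ^~ w)].
Proof.
move=> mg [N lg].
have mtup := @measurable_tup R _ Omega N (fun i w => P i w) (fun i _ => mP i).
have := @measurable_tup R _ _ n (fun j (s : N.-tuple R) => g j (nth 0 s)) (fun j _ => mg N j).
move=> /measurableT_comp /(_ mtup) /(_ measurableT _ mA); rewrite setTI.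
congr (measurable _); apply/seteqP; split => w /=.
  exact: (stick_event_tup A (P ^~ w) lg).1.
exact: (stick_event_tup A (P ^~ w) lg).2.
Qed.

(** The common increment [x] is the probability of leaving the block at time N + 1. It is computed
    as a difference, all continuations minus the one that stays, which avoids a sum over the next
    state. The event reads the first N + 1 masses only, so both terms carry the same Beta integral
    [bp]. *)
Let finish_step t N m : compat t N m -> m.+1 = n -> Q (zf m) (zf m) < 1 ->
  exists2 x, x \is a fin_num &
     Lv t N = (x + Lv t N.+1)%E /\ Rv t N m 0 = (x + Rv t N.+1 m 0)%E.
Proof.
move=> cp mn q1; have [h e c] := cp; have tN : t N.+1 = t N by exact: c.
set F := word_event t N.+1 `&` [set w | stick_event A (finish_sums t N) (P ^~ w)].
set F' := word_event t N.+2 `&` [set w | stick_event A (finish_sums t N) (P ^~ w)].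
have mev : measurable [set w | stick_event A (finish_sums t N) (P ^~ w)].
  by apply: measurable_stick_event => //; exists N.+1.
have mFF : measurable F by apply: measurableI => //; exact: measurable_word_event.
have mFF' : measurable F' by apply: measurableI => //; exact: measurable_word_event.
pose bp := beta1_prod (nseq N.+1 theta) [set xs | stick_event A (finish_sums t N) (stick xs)].
have PF : Pr F = ((word_prob t N.+1)%:E * bp)%E by rewrite /F word_stick_law.
have PF' : Pr F' = ((word_prob t N.+2)%:E * bp)%E by rewrite /F' word_stick_lawS.
have bpE : bp = beta1_prod (nseq N.+1 theta ++ [::]) (B (clump_index t N)).
  rewrite cats0; apply: eq_beta1_prod => s; rewrite size_nseq => sz.
  rewrite /= /stick_event /B /=; have -> : tup n (finish_sums t N ^~ (stick s)) = tup n
    (clump_sum (clump_index t N) s); last by [].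
  apply: eq_tup => j _; rewrite /finish_sums /clump_sum sz big_nat_cond [RHS]big_nat_cond.
  apply: eq_bigl => i; case iN : (i < N.+1)%N; rewrite ?andbF//= /clump_index.
  by rewrite (_ : i - N = 0)%N ?addn0//; lia.
have fbp : bp \is a fin_num.
  rewrite ge0_fin_numE; last by apply: beta1_prod_ge0; exact: nnegs_th.
  rewrite bpE (@le_lt_trans _ _ 1%E)// ?ltry//.
  by apply: beta1_prod_le1 => //; exact: (nnegs_params _ [::]).
exists (Pr (F `\` F')); first by apply: fin_num_measure; exact: measurableD.
split.
  rewrite /Lv -measureU//; last 3 first.
  - exact: measurableD.
  - by apply: measurableI => //; exact: measurable_word_event.
  - apply/seteqP; split => w //= [[[_ evw] nF'] [pw' _]]; apply: nF'; split=> //.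
  congr (Pr _); apply/seteqP; split => w /=.
    move=> [pw Ew]; have [ne|eq] := boolP (T N.+1 w == t N).
      by right; split=> //; apply: preS => //; rewrite tN; apply/eqP.
    left; split; first by split=> //; apply/(finish_event cp mn pw eq).
    by move=> [pw' _]; move: eq; rewrite -tN (pw' N.+1)// eqxx.
  move=> [[[pw evw] nF']|[pw Ew]]; last by split=> //; exact: pre_le pw.
  split=> //; apply/(finish_event cp mn pw _) => //.
  apply/negP => /eqP eq; apply: nF'; split=> //; apply: preS => //.
  by rewrite tN.
have PD : Pr (F `\` F') = (Pr F - Pr F')%E.
  rewrite -[X in (_ - Pr X)%E](@setIidr _ F); last first.
    by move=> w [pw evw]; split=> //; exact: pre_le pw.
  by apply: measureD => //; rewrite -ge0_fin_numE// fin_num_measure.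
rewrite (Rv_step 0 cp q1); congr (_ + _)%E.
rewrite -[LHS]/((word_prob t N.+1 * (1 * (1 - Q (zf m) (zf m))))%:E *
  beta1_prod (nseq N.+1 theta ++ [::]) (B (clump_index t N)))%E.
rewrite -bpE PD PF PF' (word_prob_const cp) -(fineK fbp) -!EFinM -EFinB; congr (_%:E); ring.
Qed.

(** On [E] a path that leaves block [m] must continue with [zf m.+1]. This is the word [t1], which
    has one block less to open, so the induction hypothesis evaluates the increment. *)
Let switch_step t N m k : compat t N m -> (m + k.+2 = n)%N -> Q (zf m) (zf m) < 1 ->
  (forall t' N', compat t' N' m.+1 -> Lv t' N' = Rv t' N' m.+1 k) ->
  exists2 x, x \is a fin_num &
     Lv t N = (x + Lv t N.+1)%E /\ Rv t N m k.+1 = (x + Rv t N.+1 m k.+1)%E.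
Proof.
move=> cp mn q1 ih; have [h e c] := cp; have tN : t N.+1 = t N by exact: c.
have mn1 : (m.+1 < n)%N by lia.
(* Equal consecutive states cannot come from a switch: no path in [E] leaves the block, and [K]
   gives this transition probability 0, so the increment is 0. *)
have [zz|zz] := eqVneq (zf m.+1) (zf m).
  exists 0%E => //; rewrite !add0e; split.
    congr (Pr _); apply/seteqP; split => w [pw Ew]; split=> //; last exact: pre_le pw.
    apply: preS => //; rewrite tN; apply/eqP/negPn/negP => ne.
    by move/negP: (ne); apply; rewrite (next_state cp mn1 pw Ew ne) zz (compat_zf cp).
  have K0 : K (zf m) (zf m.+1) = 0 by rewrite zz K_same// lt_eqF.
  by rewrite /Rv /= K0 !mul0r !mulr0 !mul0e.
pose t1 i := if (i <= N)%N then t i else zf m.+1.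
have t1N i : (i <= N)%N -> t1 i = t i by rewrite /t1 => ->.
have t1S i : (N < i)%N -> t1 i = zf m.+1 by rewrite /t1 ltnNge => /negbTE ->.
have b1 i : (i <= N)%N -> blk t1 i = blk t i by move=> iN; exact: (eq_blk t1N).
have bS : blk t1 N.+1 = m.+1.
  by rewrite blkS b1// e t1S// t1N// (compat_zf cp) zz addn1.
have c1 i : (N.+1 <= i)%N -> t1 i = t1 N.+1 by move=> Ni; rewrite !t1S.
have cp1 : compat t1 N.+1 m.+1.
  split=> // i; rewrite leq_eqVlt => /orP[/eqP ->|]; first by rewrite bS t1S.
  by rewrite ltnS => iN; rewrite t1N// b1// h.
exists (Lv t1 N.+1); first exact: fin_Lv.
split.
  rewrite /Lv -measureU//; last 3 first.
  - by apply: measurableI => //; exact: measurable_word_event.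
  - by apply: measurableI => //; exact: measurable_word_event.
  - apply/seteqP; split => w //= [[pw _] [pw' _]].
    have := pw N.+1 (leqnn _); rewrite (pw' N.+1 (leqnn _)) t1S// tN (compat_zf cp).
    by move=> /esym/eqP; rewrite (negbTE zz).
  congr (Pr _); apply/seteqP; split => w /=.
    move=> [pw Ew]; have [eq|ne] := boolP (T N.+1 w == t N).
      by right; split=> //; apply: preS => //; rewrite tN; apply/eqP.
    left; split=> //; apply: preS; last by rewrite t1S// (next_state cp).
    by move=> i iN; rewrite t1N//; exact: pw.
  move=> [[pw Ew]|[pw Ew]]; split=> //; last exact: pre_le pw.
  by move=> i iN; rewrite pw ?t1N//; exact: leqW.
rewrite (Rv_step k.+1 cp q1) ih//; congr (_ + _)%E.
(* [K_switch] turns [K] times 1 - q into the transition probability of the new letter of [t1]. The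
   labels agree because both labellings give index N + 1 the label m + 1. *)
rewrite /Rv; congr (_%:E * _)%E.
  have zz' : zf m != zf m.+1 by rewrite eq_sym.
  have qn1 : Q (zf m) (zf m) != 1 by rewrite lt_eqF.
  rewrite /word_prob markov_wordS (t1S N.+1 (ltnSn N)) (t1N N (leqnn N)) (compat_zf cp).
  by rewrite (@eq_word _ t1 t)//= -(K_switch zz' qn1); ring.
apply: eq_beta1_prod => s _; rewrite /B /=.
have -> : tup n (clump_sum (clump_index t1 N.+1) s) = tup n (clump_sum (clump_index t N) s);
  last by [].
apply: eq_tup => j _; apply: eq_clump_sum => i _; rewrite /clump_index.
have [iN|Ni] := leqP i N; first by rewrite b1//; lia.
by rewrite (blk_const c1)// (blk_const c) ?(ltnW Ni)// bS e; lia.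
Qed.

(** * Absorbing states *)

Let chain_absorb x l : Q x x = 1 -> chain_prod K x l = (all (pred1 x) l)%:R.
Proof.
move=> qx; have G0 : theta_QmI theta Q x x = 0.
  by apply/eqP; rewrite -oppr_eq0 -/(par x) parE qx subrr mulr0.
elim: l => [//|y l ih] /=; have [->|yx] := eqVneq y x.
  by rewrite ih /K /gen_kernel eqxx /= G0 eqxx mul1r.
by rewrite /K /gen_kernel eq_sym yx /= G0 eqxx mul0r.
Qed.

(** Besides its letters before [N], clump [m] receives all the remaining mass when [T] never leaves
    it; only the first [N] masses are read. *)
Let absorb_sums (t : nat -> X) N (m j : nat) (p : nat -> R) : R :=
  \sum_(0 <= i < N | blk t i == j) p i +
  (m == j)%:R * (1 - \sum_(0 <= i < N) p i).

Let cwise_absorb_sums t N m : cwise_measurable (absorb_sums t N m).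
Proof.
move=> M j; apply: measurable_funD; first exact: measurable_psum.
apply: measurable_funM => //; apply: measurable_funB => //.
exact: (@measurable_psum xpredT).
Qed.

Let absorb_sums_depends_below t N m : depends_below N (absorb_sums t N m).
Proof.
move=> j p p' pp'; rewrite /absorb_sums (@eq_psum xpredT _ p p')//.
by rewrite (@eq_psum (fun i => blk t i == j) _ p p').
Qed.

(** From [N] on every letter belongs to block [m], and the masses from there add up to 1 minus the
    first [N]. *)
Let clump_absorb t N m j p : compat t N m ->
  (fun M => \sum_(0 <= i < M) p i) @ \oo --> (1 : R) -> clump t p j = absorb_sums t N m j p.
Proof.
move=> [h e c] hS; rewrite clumpE; apply/cvg_lim => //.
have H : (fun M => \sum_(0 <= i < N | blk t i == j) p i +
      (m == j)%:R * (\sum_(0 <= i < M) p i - \sum_(0 <= i < N) p i)) @ \oo --> absorb_sums t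
        N m j p.
  apply: cvgD; first exact: cvg_cst.
  by apply: cvgM; [exact: cvg_cst|apply: cvgB => //; exact: cvg_cst].
apply: cvg_trans H; apply: near_eq_cvg; near=> M.
have NM : (N <= M)%N by near: M; exact: nbhs_infty_ge.
rewrite (big_cat_nat (leq0n _) NM) /= [in RHS](big_cat_nat (leq0n _) NM) /=.
congr (_ + _); rewrite (addrC (\sum_(0 <= i < N) p i)) addrK big_nat_cond.
have bE i : (N <= i)%N -> blk t i = m by move=> Ni; rewrite (blk_const c)// e.
have [<-|mj] := eqVneq m j.
  rewrite mul1r [RHS]big_nat_cond; apply: eq_bigl => i; rewrite andbT.
  by case Ni : (N <= i)%N => //=; rewrite bE// eqxx andbT.
rewrite mul0r [RHS]big_nat_cond big1// => i /andP[/andP[Ni _]]; rewrite bE//.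
by rewrite (negbTE mj).
Unshelve. all: by end_near. Qed.

Let null_or (F G : Omega -> Prop) :
  measurable [set w | F w] -> measurable [set w | G w] ->
  Pr [set w | F w] = 0%E -> Pr [set w | G w] = 0%E -> Pr [set w | F w \/ G w] = 0%E.
Proof. by move=> mF mG F0 G0; rewrite -F0; exact: measureU0. Qed.

(** After the word, the path stays on [t] and the masses sum to 1 almost surely, so [E] becomes an
    event on the first [N] masses. If the prescribed states are all [zf m], the predicted current
    and later fractions are Beta(1,0), that is 1, so block [m] takes the whole rest there too. *)
Let absorb t N m k : (m + k.+1 = n)%N -> compat t N m -> Q (zf m) (zf m) = 1 ->
  Lv t N = Rv t N m k.
Proof.
move=> mn cp qz; have [h e c] := cp; have tN := compat_zf cp.
(* The null events to discard: leaving [t] after the given word, a negative mass, a partial sum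
   above 1, and partial sums that stay away from 1. *)
pose bad1 w := exists i, word_event t N.+1 w /\ ~ word_event t (N.+1 + i) w.
pose bad2 w := exists i, word_event t i.+1 w /\ P i w < 0.
pose bad3 w := exists M, word_event t M w /\ 1 < \sum_(0 <= i < M) P i w.
pose bad4 w := exists l, forall M, word_event t M w /\ \sum_(0 <= i < M) P i w < 1 - l.+1%:R^-1.
have mPS M : measurable_fun [set: Omega] (fun w => \sum_(0 <= i < M) P i w).
  by apply: measurable_sum => i.
have mlt (f g : Omega -> R) : measurable_fun setT f -> measurable_fun setT g ->
    measurable [set w | f w < g w].
  by move=> mf mg; have := measurable_fun_ltr mf mg measurableT (_ : measurable [set true]);
    rewrite setTI; apply.
have mpre M : measurable [set w | word_event t M w] by exact: measurable_word_event.
have m1 i : measurable [set w | word_event t N.+1 w /\ ~ word_event t (N.+1 + i) w].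
  by apply: measurable_and_set => //; apply: measurable_not_set.
have m2 : measurable [set w | bad2 w].
  by apply: measurable_exists => i; apply: measurable_and_set => //; exact: mlt.
have m3 : measurable [set w | bad3 w].
  by apply: measurable_exists => i; apply: measurable_and_set => //; exact: mlt.
have m4 : measurable [set w | bad4 w].
  apply: measurable_exists => l; apply: measurable_forall => M.
  by apply: measurable_and_set => //; exact: mlt.
have m1' : measurable [set w | bad1 w] by exact: measurable_exists.
have z1 : Pr [set w | bad1 w] = 0%E.
  apply: null_exists => // i.
  have cpi l : compat t (N + l) m.
    by elim: l => [|l ih]; rewrite ?addn0// addnS; exact: compatS.
  have mwi l : word_prob t (N.+1 + l) = word_prob t N.+1.
    by elim: l => [|l ih]; rewrite ?addn0// addnS -ih addSn (word_prob_const (cpi l)) qz mulr1.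
  have -> : [set w | word_event t N.+1 w /\ ~ word_event t (N.+1 + i) w] = word_event t N.+1
    `\` word_event t (N.+1 + i) by [].
  have -> : Pr (word_event t N.+1 `\` word_event t (N.+1 + i)) =
      (Pr (word_event t N.+1) - Pr (word_event t N.+1 `&` word_event t (N.+1 + i)))%E.
    by apply: measureD; [exact: measurable_word_event|exact: measurable_word_event|rewrite
      [ltLHS]word_event_prob ltry].
  rewrite setIidr; last by move=> w; apply: pre_le; exact: leq_addr.
  by rewrite !word_event_prob mwi subee.
have mb34 := measurable_or_set m3 m4; have mb := measurable_or_set m2 mb34.
have mbad := measurable_or_set m1' mb.
have bad0 : Pr [set w | bad1 w \/ bad2 w \/ bad3 w \/ bad4 w] = 0%E.
  apply: null_or => //; apply: null_or => //; first exact: null_neg.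
  by apply: null_or => //; [exact: null_sum_gt1|exact: null_sum_lt1].
have good w : ~ (bad1 w \/ bad2 w \/ bad3 w \/ bad4 w) -> word_event t N.+1 w ->
    T ^~ w = t /\ (fun M => \sum_(0 <= i < M) P i w) @ \oo --> (1 : R).
  move=> nb pw; have pr M : word_event t M w.
    have [/pre_le|/ltnW] := leqP M N.+1; first exact.
    move=> NM; rewrite -(subnKC NM); apply: contrapT => np; apply: nb; left.
    by exists (M - N.+1)%N.
  split; first by apply/funext => i; exact: (pr i.+1).
  have P0 i : 0 <= P i w.
    by rewrite leNgt; apply/negP => lt; apply: nb; right; left; exists i.
  have le1 M : \sum_(0 <= i < M) P i w <= 1.
    by rewrite leNgt; apply/negP => lt; apply: nb; right; right; left; exists M.
  apply/cvgrPdist_le => eps eps0; pose l := Num.truncn eps^-1.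
  have leps : l.+1%:R^-1 <= eps.
    by rewrite invf_ple ?posrE ?ltr0n//; apply/ltW/truncnS_gt.
  have [M hM] : exists M, 1 - l.+1%:R^-1 <= \sum_(0 <= i < M) P i w.
    apply: contrapT => nM; apply: nb; right; right; right; exists l => M; split=> //.
    by rewrite ltNge; apply/negP => le; apply: nM; exists M.
  exists M => // M' /= MM'; rewrite ger0_norm ?subr_ge0// lerBlDr -lerBlDl.
  apply: (le_trans _ (le_trans hM _)); first by rewrite lerD2l lerN2.
  by rewrite (big_cat_nat (leq0n _) MM') /= lerDl sumr_ge0.
have mev : measurable [set w | stick_event A (absorb_sums t N m) (P ^~ w)].
  by apply: measurable_stick_event => //; exists N.
have mpE : measurable (word_event t N.+1 `&` E).
  by apply: measurableI => //; exact: measurable_word_event.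
(* [switch_state] repeats the absorbing state, so the prescribed states after block [m] must all be
   [zf m]; otherwise both sides are 0. *)
pose b := all (pred1 (zf m)) (map zf (iota m.+1 k)).
have ss j : (m <= j)%N -> switch_state t j = zf m.
  by move=> mj; rewrite (switch_state_const c) ?e.
have event w : ~ (bad1 w \/ bad2 w \/ bad3 w \/ bad4 w) -> word_event t N.+1 w ->
    E w <-> b /\ stick_event A (absorb_sums t N m) (P ^~ w).
  move=> nb pw; have [TE hS] := good w nb pw; rewrite /E /= TE.
  have -> : tup n (fun j => clump t (P ^~ w) j) = tup n (absorb_sums t N m ^~ (P ^~ w)).
    by apply: eq_tup => j _; exact: clump_absorb.
  split=> [[ssE evw]|[/allP hb evw]]; split=> //.
    apply/allP => _ /mapP[j + ->]; rewrite mem_iota => /andP[mj jn].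
    have jn' : (j < n)%N by rewrite -mn addnS -addSn.
    by have /= <- := ssE (Ordinal jn'); rewrite ss// ltnW.
  move=> [j jn] /=; have [mj|jm] := ltnP m j.
    rewrite (ss _ (ltnW mj)); apply/esym/eqP; apply: hb; apply: map_f.
    by rewrite mem_iota mj addSn -addnS mn.
  have [|i iN ij] := @blk_ivt _ t N j; first by rewrite e.
  by rewrite -ij switch_state_blk h.
rewrite /Rv chain_absorb// -/b; case hb : b; last first.
  rewrite mulr0 mul0e -(measure0 Pr); apply: (eq_measure_off_null mpE _ mbad bad0) => //.
  by move=> w nb; split=> // -[pw /(event w nb pw)[]]; rewrite hb.
have mpev : measurable (word_event t N.+1 `&` [set w | stick_event A (absorb_sums t N m) (P
  ^~ w)]).
  by apply: measurableI => //; exact: measurable_word_event.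
transitivity (Pr (word_event t N.+1 `&` [set w | stick_event A (absorb_sums t N m) (P ^~ w)])).
  apply: (eq_measure_off_null mpE mpev mbad bad0) => w nb.
  by split=> -[pw hw]; split=> //; [have [] := (event w nb pw).1 hw|apply/(event w nb pw)].
rewrite word_stick_lawS// mulr1; congr (_ * _)%E.
have -> : map par (map zf (iota m k.+1)) = nseq k.+1 0.
  have /all_pred1P := hb; rewrite size_map size_iota /= => ->.
  by rewrite map_nseq parE qz subrr mulr0.
rewrite !beta1_prodE beta1_iter_cat; apply: eq_beta1_iter => s; rewrite size_nseq => sz _.
rewrite beta1_iter_nseq0; congr (_%:E); apply: indicE_iff.
suff iff : A (tup n (clump_sum (clump_index t N) (s ++ nseq k.+1 1))) <-> A (tup n
  (absorb_sums t N m ^~ (stick s))).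
  exact: (iff_sym iff).
suff -> : tup n (absorb_sums t N m ^~ (stick s)) = tup n (clump_sum (clump_index t N) (s ++
  nseq k.+1 1)) by [].
apply: eq_tup => j _; rewrite clump_sum_cat clump_sum_nseq1 addn0 sz /absorb_sums -[in X in 1
  - X]sz sum_stick subKr mulrC.
congr (_ + _ * _); last by rewrite /clump_index subnn addn0 e.
rewrite /clump_sum sz big_nat_cond [RHS]big_nat_cond; apply: eq_bigl => i.
case iN : (i < N)%N; rewrite ?andbF//= /clump_index.
by rewrite (_ : i - N = 0)%N ?addn0//; lia.
Qed.

(** Induction on the number [k] of blocks left to open, over all words at once because [switch_step]
    moves to another path. An absorbing state is settled directly; otherwise [defect_eq0] reduces
    the claim to the one-step recursion. *)
Let claim k t N m : (m + k.+1 = n)%N -> compat t N m -> Lv t N = Rv t N m k.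
Proof.
elim: k t N m => [|k ih] t N m mn cp.
  have [q1|q1] := eqVneq (Q (zf m) (zf m)) 1; first exact: absorb.
  have {}q1 : Q (zf m) (zf m) < 1 by rewrite lt_neqAle q1 Q_le1.
  apply: (defect_eq0 cp q1) => N' cp'; apply: finish_step => //.
  by rewrite -mn addn1.
have [q1|q1] := eqVneq (Q (zf m) (zf m)) 1; first exact: absorb.
have {}q1 : Q (zf m) (zf m) < 1 by rewrite lt_neqAle q1 Q_le1.
apply: (defect_eq0 cp q1) => N' cp'; apply: switch_step => // t' N'' cp''.
by apply: ih => //; rewrite -mn addSnnS.
Qed.

(** [claim] for the word with the single letter [zf 0]: no letter precedes the last, so each
    fraction is a whole clump, [clump_index t 0] is the identity and the clump sums are the
    sticks. *)
Lemma clumped_law k : n = k.+1 ->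
  Pr E = ((markov_prob mu K (map zf (iota 0 n)))%:E *
    beta1_prod (map par (map zf (iota 0 n))) [set xs | A (tup n (stick xs))])%E.
Proof.
move=> nk; pose t (i : nat) := zf 0%N.
have b0 i : blk t i = 0%N by elim: i => //= i ->; rewrite eqxx.
have cp : compat t 0 0 by split=> // i _; rewrite b0.
have := claim (_ : 0 + k.+1 = n)%N cp; rewrite add0n -nk => /(_ erefl).
(* [E] prescribes the initial state, so it lies in the event of this word. *)
rewrite /Lv (_ : word_event t 1 `&` E = E); last first.
  apply/seteqP; split => w /=; first by case.
  move=> Ew; split=> // i; rewrite ltnS leqn0 => /eqP ->; have [Ew1 _] := Ew.
  have n0 : (0 < n)%N by rewrite nk.
  exact: (Ew1 (Ordinal n0)).
have -> : iota 0 n = 0%N :: iota 1 k by rewrite nk.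
move=> ->; rewrite /Rv /word_prob /= mulr1; congr (_ * _)%E.
apply: (@eq_beta1_prod (par (zf 0%N) :: map par (map zf (iota 1 k))) (B (clump_index t 0))
  [set xs | A (tup n (stick xs))]) => s; rewrite /= !size_map size_iota => sz.
rewrite /B /=; suff -> : tup n (clump_sum (clump_index t 0) s) = tup n (stick s) by [].
apply: eq_tup => j jn; rewrite /clump_sum; under eq_bigl => i do rewrite /clump_index b0
  subn0 add0n.
by rewrite big_nat1_eq sz -nk jn.
Qed.

End Claim.
End Main.

Unset Implicit Arguments.

Theorem mainTheorem2 (R : realType) (d : measure_display)
  (Omega : measurableType d) (Pr : probability Omega R) (X : countType)
  (theta : R) (mu : X -> R) (Q : X -> X -> R)
  (P : nat -> Omega -> R) (T : nat -> Omega -> X) :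
  0 < theta ->
  (forall x, 0 <= mu x) -> (\esum_(x in [set: X]) (mu x)%:E = 1)%E ->
  (forall x y, 0 <= Q x y) ->
  (forall x, \esum_(y in [set: X]) (Q x y)%:E = 1)%E ->
  (forall i x, measurable [set w | T i w = x]) ->
  (forall i, measurable_fun [set: Omega] (P i)) ->
  GEM_indep_markov Pr theta P T mu Q ->
  MCcGEM Pr (theta_QmI theta Q) mu
    (fun j w => clump (T ^~ w) (P ^~ w) j)
    (fun j w => switch_state (T ^~ w) j).
Proof.
move=> th0 mu0 _ Q0 Q1 mT mP law [|n] zs A mA.
  (* For n = 0 both sides are the indicator of [A] at the empty tuple. *)
  rewrite (tuple0 zs) /= mul1e.
  have [h|h] := pselect (A [tuple]).
    rewrite [X in Pr X](_ : _ = setT) ?probability_setT ?indicE ?mem_set//=.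
      by rewrite tuple0.
    by apply/seteqP; split=> // w _; split=> [[]//|]; rewrite tuple0.
  rewrite [X in Pr X](_ : _ = set0) ?measure0 ?indicE ?memNset//=.
    by rewrite tuple0.
  by apply/seteqP; split=> // w [_]; rewrite tuple0.
pose zf := nth (thead zs) zs.
have zsE : map zf (iota 0 n.+1) = zs.
  by rewrite map_nth_iota0 ?size_tuple// take_oversize// size_tuple.
have := clumped_law th0 mu0 Q0 Q1 mT mP law zf mA erefl; rewrite zsE => <-.
congr (Pr _); apply/seteqP; split => w /= [h Aw]; split=> // i.
  by rewrite h (tnth_nth (thead zs)).
by rewrite h (tnth_nth (thead zs)).
Qed.
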